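(* Let $\mathbb{K}$ be an algebraically closed field of characteristic zero, let $n\ge2$, let $R$ be a local algebra over $\mathbb{K}$ of dimension $n+2$ with maximal ideal $\mathfrak{m}$, and let $F$ be a bilinear symmetric form of rank $n+1$ on $R$ such that $F(1,1)=0$. Assume that $W$ is a hyperplane in $\mathfrak{m}$ such that $$F(ab_1,b_2)+F(b_1,ab_2)=0\quad\text{for all } b_1,b_2\in R,\ a\in W.$$ Then there is a basis $e_0=1,e_1,\ldots,e_n,e_{n+1}$ of $R$ with $W=\langle e_1,\ldots,e_n\rangle$ and $\mathfrak{m}=\langle e_1,\ldots,e_{n+1}\rangle$ such that the matrix of $F$ in this basis is $$M(F)=\begin{pmatrix}0&0&\ldots&0&0&1\\0&-1&\ldots&0&0&0\\\vdots&\vdots&\ddots&\vdots&\vdots&\vdots\\0&0&\ldots&-1&0&0\\0&0&\ldots&0&0&0\\1&0&\ldots&0&0&0\end{pmatrix},$$ i.e. $F(e_0,e_{n+1})=F(e_{n+1},e_0)=1$, $F(e_i,e_i)=-1$ for $1\le i\le n-1$, and all other values $F(e_i,e_j)$ are zero; and $R$ is one of the following algebras: (1) for $n\ge3$, $$\mathbb{K}[e_1,\ldots,e_n]/\bigl(e_ie_j-\lambda_{ij}e_n,\ e_i^2-e_j^2-(\lambda_{ii}-\lambda_{jj})e_n,\ e_se_n;\ 1\le i<j\le n-1,\ 1\le s\le n\bigr),$$ where $\lambda_{ij}$ are the entries of a symmetric block diagonal $(n-1)\times(n-1)$-matrix $\Lambda$ each of whose blocks $\Lambda_k$ is of the canonical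 form described in the context, with some $\lambda_k\in\mathbb{K}$; (2) for $n=2$, $\mathbb{K}[e_1,e_2]/(e_1^3,e_1e_2,e_2^2)$ or $\mathbb{K}[e_1]/(e_1^4)$ with $e_2=e_1^3$, $e_3=e_1^2$.
   Context: A local algebra is a finite-dimensional commutative associative local $\mathbb{K}$-algebra with unit. A hyperplane in $\mathfrak{m}$ is a linear subspace of codimension one. The letters $e_i$ in the presentations of $R$ denote the corresponding basis elements: the homomorphism from the polynomial algebra to $R$ sending each variable to the basis element with the same name is surjective, with kernel generated by the listed relations. Canonical blocks: let $i=\sqrt{-1}\in\mathbb{K}$. A block $\Lambda_k$ of size $q\times q$ with parameter $\lambda_k\in\mathbb{K}$ is $$\Lambda_k=\lambda_k E+\tfrac12 A+\tfrac{i}{2}B,$$ where $E$ is the identity matrix; $A$ has entries $A_{st}=1$ if $|s-t|=1$ and $0$ otherwise; and $B$ has entries $B_{st}=1$ if $s+t=q$, $B_{st}=-1$ if $s+t=q+2$, and $0$ otherwise ($1\le s,t\le q$). For example, blocks of size $1$ are $(\lambda_k)$ and blocks of size $2$ are $$\begin{pmatrix}\lambda_k+\frac{i}{2}&\frac12\\ \frac12&\lambda_k-\frac{i}{2}\end{pmatrix}.$$ *)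

(* Defs.v *)
From HB Require Import structures.
From mathcomp Require Import all_boot all_order all_algebra.
From mathcomp Require Import falgebra.
From mathcomp Require Import mpoly.

Set Implicit Arguments.
Unset Strict Implicit.
Unset Printing Implicit Defensive.

Import GRing.Theory.
Local Open Scope ring_scope.

#[short(type="comFalgType")]
HB.structure Definition ComFalgebra (K : nzRingType) :=
  {R of Vector K R & GRing.ComUnitAlgebra K R}.

Section Ideals.
Variables (K : fieldType) (R : comFalgType K).
(* Every ideal of a unital algebra is a linear subspace, so ideals are
   represented by elements of [{vspace R}]. *)
Implicit Types I m : {vspace R}.

Definition is_ideal I : Prop := forall a x : R, x \in I -> a * x \in I.

Definition is_maximal_ideal m : Prop :=
  [/\ is_ideal m, m <> fullv
    & forall I, is_ideal I -> (m <= I)%VS -> I = m \/ I = fullv].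

Definition local_with_maximal_ideal m : Prop :=
  is_maximal_ideal m /\ (forall m', is_maximal_ideal m' -> m' = m).

End Ideals.

Section Forms.
Variables (K : fieldType) (V : vectType K) (F : {symmetric V}).

Definition gram_mx d (e : d.-tuple V) : 'M[K]_d :=
  \matrix_(i, j) F e`_i e`_j.

Definition form_rank : nat := \rank (gram_mx (vbasis {:V})).

End Forms.

Definition normal_form_mx (K : fieldType) (n : nat) : 'M[K]_n.+2 :=
  \matrix_(i, j)
    if ((i == 0%N :> nat) && (j == n.+1 :> nat))
       || ((i == n.+1 :> nat) && (j == 0%N :> nat)) then 1
    else if (i == j) && (0 < i < n)%N then -1
    else 0.

(* Indices are shifted to start from 0: for 1 <= s, t <= q, the conditions
   s + t = q and s + t = q + 2 become s + t + 2 = q and s + t = q. *)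
Definition canonical_block (K : fieldType) (im : K) (q : nat) (lam : K)
    : 'M[K]_q :=
  lam%:M
  + 2^-1 *: (\matrix_(s, t)
               ((s.+1 == t :> nat) || (t.+1 == s :> nat))%:R)
  + (im / 2) *: (\matrix_(s, t)
                  (((s + t).+2 == q)%N%:R - ((s + t)%N == q)%:R)).

Definition is_canonical_mx (K : fieldType) (im : K) (d : nat)
    (L : 'M[K]_d) : Prop :=
  exists (r : nat) (q : 'I_r -> nat) (lam : 'I_r -> K)
         (eq_d : (\sum_k q k)%N = d),
    (forall k, 0 < q k)%N
    /\ L = castmx (eq_d, eq_d) (\mxdiag_k canonical_block im (q k) (lam k)).

Definition in_ideal_generated_by (A : comNzRingType) (S : A -> Prop) (p : A)
    : Prop :=
  exists s : seq (A * A),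
    (forall x, x \in s -> S x.2) /\ p = \sum_(x <- s) x.1 * x.2.

Definition presented_by (K : fieldType) (R : comFalgType K) (d : nat)
    (v : 'I_d -> R) (S : {mpoly K[d]} -> Prop) : Prop :=
  let ev := mmap (GRing.in_alg R) v in
  (forall x : R, exists p : {mpoly K[d]}, ev p = x)
  /\ (forall p : {mpoly K[d]}, ev p = 0 <-> in_ideal_generated_by S p).

(* The variables are e_1, ..., e_{d+1}, so d + 1 plays the role of n; the
   variable e_n is ['X_ord_max] and [widen_ord (leqnSn d)] is the inclusion of
   the indices of e_1, ..., e_{n-1}. *)
Inductive Lambda_relation (K : fieldType) (d : nat) (L : 'M[K]_d)
    : {mpoly K[d.+1]} -> Prop :=
| LambdaMixed (i j : 'I_d) of (i < j)%N :
    Lambda_relation L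
      ('X_(widen_ord (leqnSn d) i) * 'X_(widen_ord (leqnSn d) j)
       - L i j *: 'X_ord_max)
| LambdaSquare (i j : 'I_d) of (i < j)%N :
    Lambda_relation L
      ('X_(widen_ord (leqnSn d) i) ^+ 2 - 'X_(widen_ord (leqnSn d) j) ^+ 2
       - (L i i - L j j) *: 'X_ord_max)
| LambdaSocle (s : 'I_d.+1) :
    Lambda_relation L ('X_s * 'X_ord_max).

(* Main.v *)
(** Since F(a, b) = - F(1, ab) for a in W, the form kills 1 on W, its kernel is
    a line <k> inside W with m k = 0, and W carries vectors w_i with
    F(w_i, w_j) = - delta_ij.  The trilinear form F(w_i w_j, w_l) is
    symmetric in i, j and changes sign under cyclic shifts, hence vanishes;
    therefore w_i w_j = delta_ij z + M_ij k with M symmetric, and nilpotency of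
    z forces F(z, z) = 0.  It remains to bring M to canonical form by an
    orthogonal change of the w_i.  For a self-adjoint T with eigenvalue lam, put
    N = T - lam; a Jordan chain of N of maximal length q + 1 can be started at a
    vector v with <v N^k, v> = [k = q].  In this chain the form has the Gram
    matrix H (the flip) and N is the shift J, and (1 - i H) J = B (1 - i H) with
    B the canonical block, while (1 - i H) H (1 - i H) = -2 i.  One splits off
    the chain and proceeds with its orthogonal complement. *)

Require Import Defs.
From HB Require Import structures.
From mathcomp Require Import all_boot all_order all_algebra.
From mathcomp Require Import falgebra.
From mathcomp Require Import mpoly.
From mathcomp Require Import ring zify.

Set Implicit Arguments.
Unset Strict Implicit.
Unset Printing Implicit Defensive.

Import GRing.Theory.
Local Open Scope ring_scope.

(** * Orthogonal normal form of symmetric matrices *)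

Lemma addmxE (V : nmodType) m n (A B : 'M[V]_(m, n)) i j :
  (A + B) i j = A i j + B i j.
Proof. by rewrite mxE. Qed.

Lemma scalemxE (A : pzRingType) m n (a : A) (M : 'M[A]_(m, n)) i j :
  (a *: M) i j = a * M i j.
Proof. by rewrite mxE. Qed.

(** By polarization: if the diagonal entries at the indices of a nonzero [S i j] vanish, the sum of
    the two basis vectors has value [2 * S i j]. *)
Lemma symmetric_mx_nonisotropic (K : fieldType) (n : nat) (S : 'M[K]_n) :
  2%:R != 0 :> K -> S^T = S -> S != 0 ->
  exists v : 'rV_n, (v *m S *m v^T) 0 0 != 0.
Proof.
move=> nz2 symS nzS.
have [[i j] /= nzSij]: exists p : 'I_n * 'I_n, S p.1 p.2 != 0.
  apply/existsP; apply: contraNT nzS => /existsPn S0.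
  by apply/eqP/matrixP => i j; have /negPn/eqP := S0 (i, j); rewrite mxE.
have form_delta k l :
    (delta_mx (0 : 'I_1) k *m S *m (delta_mx (0 : 'I_1) l)^T) 0 0 = S k l.
  by rewrite -rowE trmx_delta -colE !mxE.
have [Sii|] := eqVneq (S i i) 0; last by exists (delta_mx 0 i); rewrite form_delta.
have [Sjj|] := eqVneq (S j j) 0; last by exists (delta_mx 0 j); rewrite form_delta.
exists (delta_mx 0 i + delta_mx 0 j).
rewrite linearD /= mulmxDr !mulmxDl.
rewrite !(addmxE, form_delta).
have -> : S j i = S i j by rewrite -[in LHS]symS mxE.
rewrite Sii Sjj add0r addr0.
by rewrite -mulr2n -mulr_natl mulf_neq0.
Qed.

Lemma closed_field_sqrt (K : closedFieldType) (a : K) : exists c, c ^+ 2 = a.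
Proof.
have /closed_rootP [c]: size ('X^2 - a%:P) != 1 by rewrite size_XnsubC.
by rewrite /root !hornerE subr_eq0 => /eqP; exists c.
Qed.

(** * Canonical blocks as conjugates of Jordan blocks *)

Section Blocks.
Variables (K : fieldType) (im : K) (q : nat).

Definition shift_mx : 'M[K]_q := \matrix_(s, t) (s.+1 == t :> nat)%:R.
Definition flip_mx : 'M[K]_q := \matrix_(s, t) ((s + t).+1 == q)%:R.

Lemma tr_flip_mx : flip_mx^T = flip_mx.
Proof. by apply/matrixP => s t; rewrite !mxE addnC. Qed.

Lemma mul_flip_mx n (M : 'M[K]_(q, n)) :
  flip_mx *m M = \matrix_(s, t) M (rev_ord s) t.
Proof.
apply/matrixP => s t; rewrite !mxE (bigD1 (rev_ord s)) //= big1 ?addr0.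
  by rewrite !mxE /= -addSn subnKC ?eqxx ?mul1r.
move=> r; rewrite -val_eqE mxE /= => ne_r.
by case: eqP => [e|_]; rewrite ?mul0r //; case/eqP: ne_r; lia.
Qed.

Lemma mulmx_flip n (M : 'M[K]_(n, q)) :
  M *m flip_mx = \matrix_(s, t) M s (rev_ord t).
Proof.
apply: trmx_inj; rewrite trmx_mul tr_flip_mx mul_flip_mx.
by apply/matrixP => s t; rewrite !mxE.
Qed.

Lemma flip_mxK : flip_mx *m flip_mx = 1%:M.
Proof.
rewrite mul_flip_mx; apply/matrixP => s t; rewrite !mxE -val_eqE /=.
by congr (_ %:R); have := ltn_ord s; have := ltn_ord t; lia.
Qed.

(** Conjugation by the flip H transposes the shift J, so A = J + HJH; likewise B = JH - HJ. *)
Lemma canonical_blockE lam : canonical_block im q lam =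
  lam%:M + 2^-1 *: (shift_mx + flip_mx *m shift_mx *m flip_mx)
  + (im / 2) *: (shift_mx *m flip_mx - flip_mx *m shift_mx).
Proof.
rewrite /canonical_block !mulmx_flip mul_flip_mx.
congr (_ + _ *: _ + _ *: _); apply/matrixP => s t; rewrite !mxE /=.
  have -> : ((q - s.+1).+1 == (q - t.+1)%N) = (t.+1 == s).
    by have := ltn_ord s; have := ltn_ord t; lia.
  by rewrite -natrD; congr (_ %:R); case: eqP; case: eqP => //; lia.
by congr (_%:R - _%:R); have := ltn_ord s; have := ltn_ord t; lia.
Qed.

Lemma canonical_block_shift lam : im ^+ 2 = -1 -> 2 != 0 :> K ->
  canonical_block im q lam *m (1%:M - im *: flip_mx) =
  (1%:M - im *: flip_mx) *m (lam%:M + shift_mx).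
Proof.
move=> im2 nz2; rewrite canonical_blockE.
rewrite !(mulmxBl, mulmxBr, mulmxDl, mulmxDr, mul1mx, mulmx1, mulmxN, mulNmx).
rewrite -!scalemxAl -!scalemxAr !(mulmxBl, mulmxDl) -!mulmxA flip_mxK !mulmxA.
rewrite !mulmx1 mul_scalar_mx mul_mx_scalar.
(* After HH = 1 both sides are linear in 1, H, J, HJ, JH and HJH, so a scalar identity for the
   entries suffices; [im2] makes the HJH terms cancel. *)
move: (flip_mx *m _ *m _) => C; move: (flip_mx *m _) (shift_mx *m _) => A B.
apply/matrixP => s t; rewrite !mxE.
by field: im2.
Qed.

End Blocks.

(** * Self-adjoint operators and their Jordan chains *)

Section JordanChains.
Variables (K : closedFieldType) (nz2 : 2%:R != 0 :> K) (n : nat).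
Variables (G : 'M[K]_n.+1) (symG : G^T = G).

(** Vectors are rows: for <u, v> = u G v^T this reads <uT, v> = <u, vT>. *)
Definition self_adjoint (T : 'M[K]_n.+1) := T *m G = G *m T^T.

Lemma self_adjoint_horner T p : self_adjoint T -> self_adjoint (horner_mx T p).
Proof.
rewrite /self_adjoint => adjT; elim/poly_ind: p => [|p c IHp].
  by rewrite rmorph0 trmx0 mul0mx mulmx0.
rewrite rmorphD rmorphM /= horner_mx_X horner_mx_C linearD /= tr_scalar_mx.
rewrite mulmxDl mulmxDr -scalar_mxC; congr (_ + _).
have comTp : horner_mx T p *m T = T *m horner_mx T p.
  exact/esym/comm_mx_horner.
rewrite -[_ * _]/(_ *m _) [in RHS]comTp trmx_mul -mulmxA adjT mulmxA IHp.
by rewrite -mulmxA.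
Qed.

Lemma self_adjoint_exp N k : self_adjoint N -> self_adjoint (N ^+ k).
Proof.
move=> adjN; have -> : N ^+ k = horner_mx N ('X ^+ k).
  by rewrite rmorphXn /= horner_mx_X.
exact: self_adjoint_horner.
Qed.

(** For self-adjoint [N] the Gram matrix of the vectors w N^j is a Hankel matrix, so this sequence
    <w N^k, w> determines it. *)
Definition chain_form (N : 'M[K]_n.+1) (w : 'rV_n.+1) k : K :=
  (w *m N ^+ k *m G *m w^T) 0 0.

Lemma chain_formD N w j k : self_adjoint N ->
  ((w *m N ^+ j) *m G *m (w *m N ^+ k)^T) 0 0 = chain_form N w (j + k).
Proof.
move=> adjN; rewrite trmx_mul /chain_form exprD -[_ ^+ j * _]/(_ *m _).
by rewrite !mulmxA -!(mulmxA _ _ G) (self_adjoint_exp k adjN) !mulmxA.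
Qed.

Lemma chain_form0 N w q k : w *m N ^+ q = 0 -> (q <= k)%N ->
  chain_form N w k = 0.
Proof.
move=> wN0 /subnKC <-; rewrite /chain_form exprD -[_ ^+ q * _]/(_ *m _).
by rewrite mulmxA wN0 !mul0mx mxE.
Qed.

Lemma chain_form_addN N w c j k : self_adjoint N ->
  chain_form N (w + c *: (w *m N ^+ j)) k =
  chain_form N w k + 2 * c * chain_form N w (k + j)
  + c ^+ 2 * chain_form N w (k + j + j).
Proof.
move=> adjN; rewrite [LHS]/chain_form mulmxDl -scalemxAl.
rewrite -(mulmxA _ (N ^+ j)) -[N ^+ j *m _]/(_ * _) -exprD.
rewrite linearD linearZ /= mulmxDr !mulmxDl -!scalemxAr -!scalemxAl.
rewrite !(addmxE, scalemxE) !chain_formD // -!/(chain_form _ _ _).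
rewrite (addnC j k); ring.
Qed.

(** Here [q + 1] is the multiplicity of a root [lam] of the minimal polynomial p = g (X -
    lam)^(q+1). By minimality h = g (X - lam)^q does not annihilate T, so the symmetric matrix h(T)
    G has a nonisotropic vector v, and v g(T) starts the chain. *)
Lemma exists_long_chain T : self_adjoint T -> G \in unitmx ->
  exists lam w q, w *m (T - lam%:M) ^+ q.+1 = 0
    /\ chain_form (T - lam%:M) w q != 0.
Proof.
move=> adjT unitG; set p := mxminpoly T.
have p_T : horner_mx T p = 0 by exact: mx_root_minpoly.
have [lam p_lam] : exists lam, root p lam.
  by apply/closed_rootP; rewrite size_mxminpoly eqSS -lt0n mxminpoly_nonconstant.
have nz_p : p != 0 by rewrite monic_neq0 ?mxminpoly_monic.
have [[|q] [g]] := multiplicity_XsubC p lam; rewrite nz_p /= => g_lam def_p.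
  by move: p_lam; rewrite def_p mulr1 (negPf g_lam).
(* As N^q g(T) N = 0, the form <v N^q g(T), v g(T)> equals g(lam) times the
   nonzero symmetric form <v N^q g(T), v>. *)
pose h := g * ('X - lam%:P) ^+ q.
have def_ph : p = h * ('X - lam%:P) by rewrite def_p exprSr mulrA.
have nz_h : h != 0 by apply: contra_neq nz_p => h0; rewrite def_ph h0 mul0r.
have nz_hT : horner_mx T h != 0.
  apply/eqP => /mxminpoly_min; rewrite -/p => /(dvdp_leq nz_h).
  by rewrite def_ph size_Mmonic ?monicXsubC // size_XsubC addn2 ltnn.
have [||v nz_v] := @symmetric_mx_nonisotropic K _ (horner_mx T h *m G) nz2.
- by rewrite trmx_mul symG self_adjoint_horner.
- by apply: contra_neq nz_hT => h0; rewrite -[LHS](mulmxK unitG) h0 mul0mx.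
have defN : T - lam%:M = horner_mx T ('X - lam%:P).
  by rewrite rmorphB /= horner_mx_X horner_mx_C.
exists lam, (v *m horner_mx T g), q; split.
  rewrite defN -rmorphXn -mulmxA -[_ *m horner_mx _ _]/(_ * _) -rmorphM -def_p.
  by rewrite /= p_T mulmx0.
have [r def_r] : exists r, g - g.[lam]%:P = r * ('X - lam%:P).
  by apply/factor_theorem; rewrite /root !hornerE subrr.
have hgT : horner_mx T (h * g) = g.[lam] *: horner_mx T h.
  rewrite -[g in h * g](subrK g.[lam]%:P) def_r mulrDr rmorphD.
  rewrite mulrCA -def_ph rmorphM /= p_T mulr0 add0r.
  by rewrite rmorphM /= horner_mx_C -[_ * _]/(_ *m _) mul_mx_scalar.
have -> : chain_form (T - lam%:M) (v *m horner_mx T g) q =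
    g.[lam] * (v *m (horner_mx T h *m G) *m v^T) 0 0.
  rewrite -scalemxE scalemxAl scalemxAr scalemxAl -hgT /chain_form trmx_mul.
  rewrite defN -rmorphXn !mulmxA -(mulmxA _ G) -self_adjoint_horner //.
  rewrite -[v *m _ *m _]mulmxA -[horner_mx T g *m _]/(_ * _) -rmorphM -/h.
  by rewrite [horner_mx T (h * g)]rmorphM -[_ * _]/(_ *m _) !mulmxA.
by rewrite mulf_neq0.
Qed.

Lemma normalize_chain N w q : self_adjoint N ->
  w *m N ^+ q.+1 = 0 -> chain_form N w q != 0 ->
  exists w', w' *m N ^+ q.+1 = 0 /\
    forall k, chain_form N w' k = (k == q)%:R.
Proof.
move=> adjN wN0 nz_w.
suff: forall j, (j <= q)%N -> exists w', [/\ w' *m N ^+ q.+1 = 0,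
    chain_form N w' q = 1
    & forall k, (q - j <= k < q)%N -> chain_form N w' k = 0].
  move=> /(_ q (leqnn q)) [w' [w'N0 w'q w'k]]; exists w'; split=> // k.
  case: ltngtP => [lt_kq|lt_qk|-> //]; last exact: chain_form0 w'N0 _.
  by apply: w'k; rewrite subnn.
(* Adding a multiple of w' N^(j+1) to w' changes the value at k = q - j - 1
   without affecting the larger values of k. *)
elim=> [_|j IHj lt_jq].
  (* Scaling the vector by [c] multiplies the form by [c ^+ 2]. *)
  have [c c2] := closed_field_sqrt (chain_form N w q)^-1.
  exists (c *: w); split=> [||k]; first by rewrite -scalemxAl wN0 scaler0.
    rewrite /chain_form linearZ /= -!scalemxAl -scalemxAr scalerA -expr2 c2.
    by rewrite scalemxE mulVf.
  by rewrite subn0 => /andP[/leq_ltn_trans le /le]; rewrite ltnn.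
have [w' [w'N0 w'q w'k]] := IHj (ltnW lt_jq).
have w'0 k : (q < k)%N -> chain_form N w' k = 0 by apply: chain_form0.
(* The correction adds 2c <w' N^q, w'> = 2c to the value at k = q - j - 1; its quadratic term has an
   exponent above q and vanishes. *)
pose c := - (chain_form N w' (q - j.+1)) / 2.
exists (w' + c *: (w' *m N ^+ j.+1)); split=> [||k /andP[le_k lt_k]].
- rewrite mulmxDl w'N0 -scalemxAl -mulmxA -[_ *m N ^+ q.+1]/(_ * _) -exprD.
  by rewrite addnC exprD -[_ * _]/(_ *m _) mulmxA w'N0 mul0mx scaler0 addr0.
- by rewrite chain_form_addN // w'q !w'0 ?mulr0 ?addr0 //; lia.
rewrite chain_form_addN // (w'0 (_ + _ + _)%N) ?mulr0 ?addr0; last by lia.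
have [def_k|ne_k] := eqVneq k (q - j.+1)%N.
  rewrite -def_k in c *; have -> : (k + j.+1 = q)%N by lia.
  by rewrite w'q /c mulr1 mulrC mulfVK // subrr.
by rewrite w'k ?w'0 ?mulr0 ?addr0 //; lia.
Qed.

End JordanChains.

(** * Orthogonal decomposition into canonical blocks *)

Section CanonicalForm.
Variables (K : closedFieldType) (nz2 : 2%:R != 0 :> K).
Variables (im : K) (im2 : im ^+ 2 = -1).

(** The rows of [P] are orthonormal and span a [T]-invariant space on which [T] has matrix [L]. As
    [k] may be smaller than [d], partial decompositions can be stacked. *)
Definition orthonormal_normal_form (d k : nat) (G T : 'M[K]_d)
    (L : 'M[K]_k) (P : 'M[K]_(k, d)) :=
  P *m G *m P^T = 1%:M /\ P *m T = L *m P.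

Lemma orthonormal_normal_form_cast d k k' (e : k = k') (G T : 'M[K]_d) L P :
  orthonormal_normal_form G T L P ->
  orthonormal_normal_form G T (castmx (e, e) L) (castmx (e, erefl d) P).
Proof. by case: k' / e. Qed.

Lemma orthonormal_normal_form_block d a b (G T : 'M[K]_d)
    (L1 : 'M_a) (P1 : 'M_(a, d)) (L2 : 'M_b) (P2 : 'M_(b, d)) :
  G^T = G -> P2 *m G *m P1^T = 0 ->
  orthonormal_normal_form G T L1 P1 -> orthonormal_normal_form G T L2 P2 ->
  orthonormal_normal_form G T (block_mx L1 0 0 L2) (col_mx P1 P2).
Proof.
move=> symG P21 [G1 T1] [G2 T2]; split; last first.
  by rewrite mul_col_mx mul_block_col !mul0mx addr0 add0r T1 T2.
have P12 : P1 *m G *m P2^T = 0.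
  by apply: trmx_inj; rewrite !trmx_mul trmxK symG mulmxA P21 trmx0.
by rewrite tr_col_mx mul_col_mx mul_col_row G1 G2 P12 P21 -scalar_mx_block.
Qed.

Lemma exists_canonical_block n (G T : 'M[K]_n.+1) :
  G^T = G -> G \in unitmx -> self_adjoint G T ->
  exists lam q Q, orthonormal_normal_form G T (canonical_block im q.+1 lam) Q.
Proof.
move=> symG unitG adjT.
have [lam [w0 [q [w0N nz_w0]]]] := exists_long_chain nz2 symG adjT unitG.
set N := T - lam%:M in w0N nz_w0.
have adjN : self_adjoint G N.
  rewrite /self_adjoint /N mulmxBl adjT linearB /= tr_scalar_mx mulmxBr.
  by rewrite scalar_mxC.
have [w [wN w_chain]] := normalize_chain nz2 adjN w0N nz_w0.
(* With H the flip, (1 - im H) H (1 - im H) = -2 im, and c^2 (-2 im) = 1. *)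
have [c c2] := closed_field_sqrt (im / 2).
pose P := \matrix_(s < q.+1) (w *m N ^+ s).
have PG : P *m G *m P^T = flip_mx K q.+1.
  apply/matrixP => s t; rewrite [RHS]mxE eqSS -w_chain -chain_formD //.
  rewrite -[w *m N ^+ s](rowK (fun s : 'I_q.+1 => w *m N ^+ s)).
  rewrite -[w *m N ^+ t](rowK (fun s : 'I_q.+1 => w *m N ^+ s)) -/P.
  by rewrite tr_row -row_mul !mxE; apply: eq_bigr => j _; rewrite !mxE.
have PN : P *m N = shift_mx K q.+1 *m P.
  apply/row_matrixP => s; rewrite !row_mul rowK -mulmxA.
  rewrite -[N ^+ s *m N]/(_ * _) -exprSr.
  rewrite [RHS]mulmx_sum_row; have [lt_sq | le_qs] := ltnP s q.
    have lt_s1 : (s.+1 < q.+1)%N by [].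
    rewrite (bigD1 (Ordinal lt_s1)) //= big1 ?addr0 => [|t].
      by rewrite !mxE eqxx scale1r rowK.
    by rewrite -val_eqE !mxE eq_sym => /negPf /= ->; rewrite scale0r.
  (* The last chain vector is sent to w N^(q+1) = 0, matching the zero last row of the shift. *)
  have -> : s = q :> nat by apply/eqP; rewrite eqn_leq le_qs -ltnS ltn_ord.
  rewrite wN big1 // => t _; rewrite !mxE.
  by rewrite gtn_eqF ?scale0r // (leq_trans (ltn_ord t)).
have PT : P *m T = (lam%:M + shift_mx K q.+1) *m P.
  by rewrite mulmxDl -PN -[T](subrK lam%:M) mulmxDr addrC scalar_mxC.
exists lam, q, (c *: ((1%:M - im *: flip_mx K q.+1) *m P)); split; last first.
  by rewrite -scalemxAl -scalemxAr mulmxA canonical_block_shift // -!mulmxA PT.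
rewrite [(c *: _)^T]linearZ /= -!scalemxAl -scalemxAr scalerA -expr2 c2.
rewrite trmx_mul [(1%:M - _)^T]linearB /= [(im *: _)^T]linearZ /=.
rewrite tr_flip_mx trmx1 -!mulmxA.
rewrite (mulmxA G) (mulmxA P) (mulmxA P) PG mulmxBr mulmx1 -scalemxAr flip_mxK.
rewrite mulmxBl mul1mx -scalemxAl mulmxBr flip_mxK -scalemxAr mulmx1.
apply/matrixP => s t; rewrite !mxE; move: (_ + _ == _)%:R => h.
by field: im2.
Qed.

(** Block data form a list of pairs (size, parameter), so that splitting off a block is a [cons];
    the families over ordinals of [is_canonical_mx] are read off at the end. *)
Definition blocks_size (s : seq (nat * K)) : nat :=
  \sum_(k < size s) (nth (0%N, 0%R) s k).1.

Definition canonical_blocks (s : seq (nat * K)) : 'M[K]_(blocks_size s) :=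
  \mxdiag_k canonical_block im (nth (0%N, 0%R) s k).1 (nth (0%N, 0%R) s k).2.

Lemma canonical_blocks_cons q lam s :
  exists e : (q + blocks_size s = blocks_size ((q, lam) :: s))%N,
  canonical_blocks ((q, lam) :: s) =
  castmx (e, e) (block_mx (canonical_block im q lam) 0 0 (canonical_blocks s)).
Proof. by eexists; apply: mxdiag_recl. Qed.

(** Induction on [d]: one block [Q] is split off, and its orthogonal complement is [T]-invariant
    with a nondegenerate restricted form. *)
Lemma exists_canonical_blocks d (G T : 'M[K]_d) :
  G^T = G -> G \in unitmx -> T *m G = G *m T^T ->
  exists s P, [/\ all (fun x => 0 < x.1)%N s, blocks_size s = d
    & orthonormal_normal_form G T (canonical_blocks s) P].
Proof.
have [k] := ubnP d; elim: k d G T => // k IHk [|n] G T /= le_k symG unitG adjT.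
  have s0 : blocks_size [::] = 0%N by rewrite /blocks_size big_ord0.
  exists [::], 0; split=> //.
  by split; apply/matrixP => i; have := ltn_ord i; rewrite {2}s0.
have [lam [q [Q [QG QT]]]] := exists_canonical_block symG unitG adjT.
pose A := kermx (G *m Q^T).
have rankA : (q.+1 + \rank A = n.+1)%N.
  have rankGQ : \rank (G *m Q^T) = q.+1.
    apply/eqP; rewrite eqn_leq rank_leq_col /= -[X in (X <= _)%N](mxrank1 K).
    by rewrite -QG -mulmxA mxrankM_maxr.
  by rewrite mxrank_ker rankGQ subnKC // -rankGQ rank_leq_row.
pose U := row_base A.
have UQ : U *m G *m Q^T = 0.
  by apply/eqP; rewrite -mulmxA -sub_kermx eq_row_base.
(* Invariance of the complement: U T G Q^T = U G T^T Q^T = U G Q^T L^T = 0, with L the block of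
   [Q]. *)
have [T' UT] : exists T', U *m T = T' *m U.
  exists (U *m T *m pinvmx U); rewrite mulmxKpV // eq_row_base sub_kermx.
  rewrite !mulmxA -(mulmxA _ T) adjT -!mulmxA -trmx_mul QT trmx_mul !mulmxA.
  by rewrite UQ mul0mx.
have U_free : row_free U := row_base_free A.
clearbody U.
pose B := col_mx Q U.
have B_free : row_free B.
  apply: inj_row_free => v; rewrite -[v]hsubmxK mul_row_col => vB0.
  have v1 : lsubmx v = 0.
    rewrite -[lsubmx v]mulmx1 -QG !mulmxA -[X in X *m _ *m _](addrK (rsubmx v *m U)).
    by rewrite vB0 sub0r !mulNmx -!(mulmxA (rsubmx v)) UQ mulmx0 oppr0.
  move: vB0; rewrite v1 mul0mx add0r => /eqP; rewrite mulmx_free_eq0 // => /eqP ->.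
  by rewrite row_mx0.
have tB_free : row_free B^T by rewrite /row_free mxrank_tr (eqP B_free) rankA.
(* A vector of the complement orthogonal to [U] is also orthogonal to [Q], hence to the basis [B] of
   the whole space. *)
have unitG' : U *m G *m U^T \in unitmx.
  rewrite -row_free_unit; apply: inj_row_free => v vG0.
  suff : v *m U *m G *m B^T == 0.
    rewrite mulmx_free_eq0 // => /eqP vUG0.
    have : v *m U == 0 by rewrite -[_ *m U](mulmxK unitG) vUG0 mul0mx.
    by rewrite mulmx_free_eq0 // => /eqP.
  rewrite tr_col_mx mul_mx_row -(mulmxA v) -(mulmxA v _ Q^T) UQ mulmx0.
  by rewrite -(mulmxA v) vG0 row_mx0.
have [||||s [P' [s_gt0 size_s [PG PT]]]] := IHk _ (U *m G *m U^T) T'.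
- by lia.
- by rewrite !trmx_mul trmxK symG mulmxA.
- exact: unitG'.
- rewrite !mulmxA -UT -!mulmxA -!trmx_mul -UT trmx_mul !mulmxA -(mulmxA U T G).
  by rewrite adjT !mulmxA.
have [e def_s] := canonical_blocks_cons q.+1 lam s.
exists ((q.+1, lam) :: s), (castmx (e, erefl _) (col_mx Q (P' *m U))).
split=> //; first by rewrite -e size_s rankA.
rewrite def_s; apply/orthonormal_normal_form_cast.
apply: orthonormal_normal_form_block => //.
  by rewrite -!mulmxA (mulmxA U) UQ mulmx0.
split; first by rewrite -PG trmx_mul !mulmxA.
by rewrite -mulmxA UT !mulmxA PT.
Qed.

(** The form [M] corresponds to the operator T = M G^-1, self-adjoint for [G]; then P M P^T = P T G
    P^T = L P G P^T = L. *)
Lemma symmetric_mx_canonical d (G M : 'M[K]_d) :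
  G^T = G -> G \in unitmx -> M^T = M ->
  exists L P : 'M[K]_d, [/\ is_canonical_mx im L, L^T = L,
    P *m G *m P^T = 1%:M & P *m M *m P^T = L].
Proof.
move=> symG unitG symM.
have [|s [P [s_gt0 size_s]]] :=
  @exists_canonical_blocks d G (M *m invmx G) symG unitG.
  by rewrite mulmxKV // trmx_mul trmx_inv symG symM mulmxA mulmxV // mul1mx.
move=> /(orthonormal_normal_form_cast size_s) [].
set P' := castmx _ _; set L := castmx _ _ => PG PM; exists L, P'.
have PML : P' *m M *m P'^T = L.
  by rewrite -[M](mulmxKV unitG) mulmxA PM -!mulmxA (mulmxA P') PG mulmx1.
split=> //; last by rewrite -PML !trmx_mul trmxK symM mulmxA.
exists (size s), (fun k => (nth (0%N, 0%R) s k).1), (fun k => (nth (0%N, 0%R) s k).2).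
by exists size_s; split=> // k; have /all_nthP := s_gt0; apply.
Qed.

End CanonicalForm.

(** * Local algebras with an invariant form *)

Import VectorInternalTheory.

(** * Units and residue field of a local algebra *)

Section LocalAlgebra.
Variables (K : fieldType) (R : comFalgType K) (m : {vspace R}).
Hypothesis locR : local_with_maximal_ideal m.

Lemma principal_ideal (x : R) : is_ideal (limg (amull x)).
Proof.
move=> a _ /memv_imgP [b _ ->]; rewrite lfunE /= mulrCA.
by apply/memv_imgP; exists (a * b); rewrite ?memvf // lfunE.
Qed.

Lemma ideal_proper (I : {vspace R}) : is_ideal I -> I <> fullv -> 1 \notin I.
Proof.
move=> idI properI; apply/negP => I1; apply: properI; apply/vspaceP => x.
by rewrite memvf -[x]mulr1 idI.
Qed.

Lemma unit_notin_max (x : R) : x \notin m -> x \is a GRing.unit.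
Proof.
have [[_ _ _] uniq_m] := locR => m'x; apply: contraNT m'x => nunit_x.
pose I0 := limg (amull x).
have I0x : x \in I0.
  by apply/memv_imgP; exists 1; rewrite ?memvf // lfunE /= mulr1.
have proper_I0 : I0 <> fullv.
  move=> I0full; have : 1 \in I0 by rewrite I0full memvf.
  case/memv_imgP => y _; rewrite lfunE /= => xy1.
  by case/unitrPr: nunit_x; exists y.
apply: contraT => m'x.
(* Membership in m being decidable, it suffices to refute, by induction on the
   codimension, that a proper ideal contains x: it would be maximal. *)
suff: forall I, is_ideal I -> I <> fullv -> x \in I -> False.
  by move=> /(_ I0 (@principal_ideal x) proper_I0 I0x).
move=> I; have [k] := ubnP (\dim {:R} - \dim I).
elim: k I => // k IHk I le_k idI properI Ix.
have maxI : is_maximal_ideal I.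
  split=> // I' idI' sII'; have [->|ne_I'] := eqVneq I' I; first by left.
  have [->|/eqP properI'] := eqVneq I' fullv; first by right.
  case: (IHk I' _ idI' properI' (subvP sII' _ Ix)).
  have lt_I : (\dim I < \dim I')%N.
    by rewrite ltnNge; apply: contra ne_I' => le; rewrite eq_sym eqEdim sII'.
  have := dimvS (subvf I'); move: lt_I le_k.
  move: (\dim I) (\dim I') (\dim {:R}) => a b c; lia.
by rewrite (uniq_m I maxI) (negPf m'x) in Ix.
Qed.

Lemma max_ideal_mull (a x : R) : x \in m -> a * x \in m.
Proof. by have [[idm _ _] _] := locR; apply: idm. Qed.

Lemma max_ideal_proper : 1 \notin m.
Proof. by have [[idm properm _] _] := locR; apply: ideal_proper. Qed.

Lemma algebra_scalar_in_max (c : K) : ((c%:A : R) \in m) = (c == 0).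
Proof.
have [-> | nz_c] := eqVneq; first by rewrite scale0r mem0v.
by rewrite rpredZeq (negPf nz_c) (negPf max_ideal_proper).
Qed.

End LocalAlgebra.

(** Multiplication by [x] has an eigenvalue [c]; then x - c annihilates a nonzero vector, so it is
    no unit and lies in [m]. *)
Lemma residue_scalar (K : closedFieldType) (R : comFalgType K) (m : {vspace R})
    (x : R) :
  local_with_maximal_ideal m -> exists c : K, x - c%:A \in m.
Proof.
move=> locR; pose A := f2mx (amull x).
have [c] : exists c, root (char_poly A) c.
  apply/closed_rootP; rewrite size_char_poly eqSS -lt0n.
  by rewrite -dimvf (leq_trans _ (dimvS (subvf <[1]>%VS))) // dim_vline oner_eq0.
rewrite -eigenvalue_root_char => /eigenvalueP [v vA nz_v].
exists c; apply: contraT => /(unit_notin_max locR) unit_xc.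
case/negP: nz_v; rewrite -(inj_eq (can_inj r2vK)) linear0.
have : (x - c%:A) * r2v v = 0.
  rewrite mulrBl mulr_algl; apply/eqP; rewrite subr_eq0 -linearZ -vA /=.
  apply/eqP; have := lfunE (x \*o @idfun R) (r2v v) => /= <-.
  by rewrite -/(amull x) unlock /= r2vK.
by move/(congr1 ( *%R (x - c%:A)^-1)); rewrite mulKr // mulr0 => ->.
Qed.

(** * Symmetric forms, Gram matrices and the radical *)

Section SymmetricForms.
Variables (K : fieldType) (V : vectType K) (F : {symmetric V}).

Lemma symC u v : F u v = F v u.
Proof. by rewrite hermC expr0 mul1r. Qed.

Lemma symDl u1 u2 v : F (u1 + u2) v = F u1 v + F u2 v.
Proof. exact: linearDl. Qed.

Lemma symZl a u v : F (a *: u) v = a * F u v.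
Proof. exact: linearZl_LR. Qed.

Lemma symDr u v1 v2 : F u (v1 + v2) = F u v1 + F u v2.
Proof. by rewrite symC symDl !(symC u). Qed.

Lemma symZr a u v : F u (a *: v) = a * F u v.
Proof. by rewrite symC symZl symC. Qed.

Lemma sym0l v : F 0 v = 0.
Proof. by rewrite -(scale0r 0) symZl mul0r. Qed.

Lemma symBl u1 u2 v : F (u1 - u2) v = F u1 v - F u2 v.
Proof. by rewrite -scaleN1r symDl symZl mulN1r. Qed.

Lemma sym_suml (I : finType) (u : I -> V) v : F (\sum_i u i) v = \sum_i F (u i) v.
Proof. by elim/big_rec2: _ => [|i y1 y2 _ <-]; rewrite ?sym0l ?symDl. Qed.

Lemma sym_sumr (I : finType) u (v : I -> V) : F u (\sum_i v i) = \sum_i F u (v i).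
Proof. by rewrite symC sym_suml; apply: eq_bigr => i _; rewrite symC. Qed.

Lemma sym_gram_mx d (e : d.-tuple V) (u : 'rV_d) (j : 'I_d) :
  F (\sum_i u 0 i *: e`_i) e`_j = (u *m gram_mx F e) 0 j.
Proof. by rewrite sym_suml !mxE; apply: eq_bigr => i _; rewrite symZl mxE. Qed.

Lemma sym_lincomb_mx p q (A : 'M_(p, q)) (u : 'I_q -> V) i j :
  F (\sum_k A i k *: u k) (\sum_k A j k *: u k) =
  (A *m (\matrix_(k, l) F (u k) (u l)) *m A^T) i j.
Proof.
rewrite sym_sumr mxE; apply: eq_bigr => l _.
rewrite symZr sym_suml !mxE mulrC; congr (_ * _); apply: eq_bigr => k _.
by rewrite symZl mxE.
Qed.

Lemma tr_gram_mx d (e : d.-tuple V) : (gram_mx F e)^T = gram_mx F e.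
Proof. by apply/matrixP => i j; rewrite !mxE symC. Qed.

(** In coordinates the radical is the left kernel of the Gram matrix, which has rank one here. *)
Lemma form_rank_kernel : (form_rank F).+1 = \dim {:V} ->
  exists k, [/\ k != 0, forall x, F k x = 0
    & forall y, (forall x, F y x = 0) -> y \in <[k]>%VS].
Proof.
move=> rankF; pose e := vbasis {:V}; have e_basis : basis_of {:V} e := vbasisP _.
pose A := gram_mx F e.
have rank_kerA : \rank (kermx A) = 1%N.
  by rewrite mxrank_ker -[X in (X - _)%N]rankF -/(form_rank F) subSnn.
pose u := nz_row (kermx A).
have nz_u : u != 0 by rewrite nz_row_eq0 -mxrank_eq0 rank_kerA.
have uA : u *m A = 0 by apply/sub_kermxP; apply: nz_row_sub.
have expand x : x = \sum_i (\row_j coord e j x) 0 i *: e`_i.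
  rewrite [LHS](coord_basis e_basis (memvf x)).
  by apply: eq_bigr => i _; rewrite mxE.
have kerP y : (forall x, F y x = 0) <-> (\row_j coord e j y) *m A = 0.
  split=> [y0 | yA x].
    by apply/rowP => j; rewrite -sym_gram_mx -expand y0 mxE.
  rewrite (expand x) sym_sumr big1 // => i _.
  by rewrite symZr {1}(expand y) sym_gram_mx yA !mxE mulr0.
pose k := \sum_i u 0 i *: e`_i.
have coord_k : \row_j coord e j k = u.
  by apply/rowP => j; rewrite mxE coord_sum_free // (basis_free e_basis).
exists k; split=> [||y /kerP yA].
- apply: contra_neq nz_u => k0; rewrite -coord_k k0.
  by apply/rowP => j; rewrite !mxE linear0.
- by apply/kerP; rewrite coord_k.
have : (\row_j coord e j y <= u)%MS.
  have /eqmxP/eqmx_sym : (u == kermx A)%MS.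
    by rewrite -(geq_leqif (mxrank_leqif_eq (nz_row_sub _))) rank_kerA rank_rV nz_u.
  by move=> eq_u; rewrite -eq_u sub_kermx yA.
case/sub_rVP => a def_y; apply/vlineP; exists a.
rewrite [LHS]expand def_y scaler_sumr; apply: eq_bigr => i _.
by rewrite mxE scalerA.
Qed.

End SymmetricForms.

(** * Frames in which the form is almost normal *)

Section Frames.
Variables (K : fieldType) (R : comFalgType K) (F : {symmetric R}) (d : nat).
Hypotheses (dimR : \dim {:R} = d.+3) (F11 : F 1 1 = 0).

(** With n = d + 1, the vectors 1, [w], [k], [z] become e_0, ..., e_{n+1}. Of the normal form only
    F(z, z) = 0 is missing; it is derived later from the multiplication. *)
Record form_frame (w : 'I_d -> R) (k z : R) : Prop := FormFrame {
  frame_1w : forall i, F 1 (w i) = 0;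
  frame_k : forall x, F k x = 0;
  frame_nz_k : k != 0;
  frame_1z : F 1 z = 1;
  frame_zw : forall i, F z (w i) = 0;
  frame_ww : forall i j, F (w i) (w j) = - (i == j)%:R
}.

Definition frame_tuple (w : 'I_d -> R) (k z : R) : d.+3.-tuple R :=
  [tuple of 1 :: rcons (rcons (mktuple w) k) z].

Lemma frame_tuple_w w k z (i : 'I_d) : (frame_tuple w k z)`_i.+1 = w i.
Proof.
rewrite /= !nth_rcons size_rcons size_map size_enum_ord ltnS ltnW //.
by rewrite ltn_ord (nth_map i) ?size_enum_ord // nth_ord_enum.
Qed.

Lemma frame_tuple_k w k z : (frame_tuple w k z)`_d.+1 = k.
Proof.
by rewrite /= !nth_rcons size_rcons size_map size_enum_ord ltnS leqnn ltnn eqxx.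
Qed.

Lemma frame_tuple_z w k z : (frame_tuple w k z)`_d.+2 = z.
Proof. by rewrite /= nth_rcons size_rcons size_map size_enum_ord ltnn eqxx. Qed.

Lemma frame_tuple_sum w k z (c : nat -> K) :
  \sum_(i < d.+3) c i *: (frame_tuple w k z)`_i =
  (c 0%N)%:A + \sum_(i < d) c i.+1 *: w i + c d.+1 *: k + c d.+2 *: z.
Proof.
rewrite -(big_mkord xpredT (fun i => c i *: (frame_tuple w k z)`_i)).
rewrite big_nat_recl // !big_nat_recr // big_mkord frame_tuple_k frame_tuple_z.
by rewrite !addrA; under eq_bigr do rewrite frame_tuple_w.
Qed.

Variables (w : 'I_d -> R) (k z : R).
Hypothesis frameP : form_frame w k z.

Lemma frame_k_r x : F x k = 0.
Proof. by rewrite symC (frame_k frameP). Qed.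

(** Pairing with 1 and with the [w j] reads off the coefficients on [z] and, up to sign, on the
    [w j]; once [z] is gone, pairing with [z] gives the coefficient on 1. The coefficient on [k] is
    invisible to [F]. *)
Lemma sym_frame_1 a b c0 (c : 'I_d -> K) :
  F (c0%:A + \sum_i c i *: w i + a *: k + b *: z) 1 = b.
Proof.
rewrite !symDl sym_suml !symZl F11 (frame_k frameP) (symC F z) (frame_1z frameP).
rewrite big1 => [|i _]; first by rewrite !mulr0 !add0r mulr1.
by rewrite symZl symC (frame_1w frameP) mulr0.
Qed.

Lemma sym_frame_w a b c0 (c : 'I_d -> K) j :
  F (c0%:A + \sum_i c i *: w i + a *: k + b *: z) (w j) = - c j.
Proof.
rewrite !symDl sym_suml !symZl (frame_1w frameP) (frame_k frameP).
rewrite (frame_zw frameP) !mulr0 !addr0 add0r (bigD1 j) //= big1 => [|i ne_i].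
  by rewrite addr0 symZl (frame_ww frameP) eqxx mulrN1.
by rewrite symZl (frame_ww frameP) (negPf ne_i) oppr0 mulr0.
Qed.

Lemma sym_frame_z a c0 (c : 'I_d -> K) :
  F (c0%:A + \sum_i c i *: w i + a *: k) z = c0.
Proof.
rewrite !symDl sym_suml !symZl (frame_1z frameP) (frame_k frameP).
rewrite big1 => [|i _]; first by rewrite mulr0 !addr0 mulr1.
by rewrite symZl symC (frame_zw frameP) mulr0.
Qed.

Lemma frame_basis : basis_of {:R} (frame_tuple w k z).
Proof.
rewrite basisEfree subvf size_tuple dimR leqnn !andbT.
(* Coefficients are extended to natural indices so that [frame_tuple_sum] applies. *)
apply/freeP => c; pose c' i := c (inord i).
have cE i : c i = c' i by rewrite /c' inord_val.
under eq_bigr do rewrite cE.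
rewrite frame_tuple_sum => c0.
have cz : c' d.+2 = 0.
  by rewrite -[LHS](sym_frame_1 (c' d.+1) _ (c' 0%N) (fun i => c' i.+1)) c0 sym0l.
have cw (i : 'I_d) : c' i.+1 = 0.
  apply/eqP; rewrite -oppr_eq0; apply/eqP.
  by rewrite -[LHS](sym_frame_w (c' d.+1) (c' d.+2) (c' 0%N) (fun i => c' i.+1)) c0 sym0l.
rewrite cz scale0r addr0 in c0.
have c1 : c' 0%N = 0.
  by rewrite -[LHS](sym_frame_z (c' d.+1) _ (fun i => c' i.+1)) c0 sym0l.
rewrite c1 scale0r add0r big1 ?add0r in c0 => [|i _]; last by rewrite cw scale0r.
have ck : c' d.+1 = 0.
  by apply/eqP; move/eqP: c0; rewrite scaler_eq0 (negPf (frame_nz_k frameP)) orbF.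
case=> -[|i] lt_i; rewrite cE //=.
have [lt_id | le_di] := ltnP i d; first exact: (cw (Ordinal lt_id)).
have [->|->] : i = d \/ i = d.+1 by lia.
  by [].
by [].
Qed.

Lemma frame_coord x : exists c0 a,
  x = c0%:A - \sum_i F x (w i) *: w i + a *: k + F x 1 *: z.
Proof.
pose c i := coord (frame_tuple w k z) (inord i) x.
have def_x : x = (c 0%N)%:A + \sum_(i < d) c i.+1 *: w i + c d.+1 *: k + c d.+2 *: z.
  rewrite -(frame_tuple_sum w k z c) {1}(coord_basis frame_basis (memvf x)).
  by apply: eq_bigr => i _; rewrite /c inord_val.
exists (c 0%N), (c d.+1); rewrite {1}def_x; congr (_ + _ + _ + _ *: _).
  rewrite -sumrN; apply: eq_bigr => i _.
  by rewrite {1}def_x sym_frame_w scaleNr opprK.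
by rewrite def_x sym_frame_1.
Qed.

(** The coefficient on 1 is a scalar lying in [m], hence 0. *)
Lemma frame_coord_max m x : local_with_maximal_ideal m ->
  (forall i, w i \in m) -> k \in m -> z \in m -> x \in m ->
  exists a, x = a *: k - \sum_i F x (w i) *: w i + F x 1 *: z.
Proof.
move=> locm mw mk mz mx; have [c0 [a def_x]] := frame_coord x.
exists a; suff -> : a *: k - \sum_i F x (w i) *: w i + F x 1 *: z = x - c0%:A.
  suff /eqP -> : c0 == 0 by rewrite scale0r subr0.
  rewrite -(algebra_scalar_in_max locm).
  have -> : (c0%:A : R) =
      x - (- (\sum_i F x (w i) *: w i) + a *: k + F x 1 *: z).
    by apply/eqP; rewrite eq_sym subr_eq !addrA -def_x.
  by rewrite rpredB // !rpredD ?rpredN ?rpredZ ?rpred_sum // => i _; rewrite rpredZ.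
apply/eqP; rewrite eq_sym subr_eq {1}def_x; apply/eqP.
by rewrite [RHS]addrC !addrA [in RHS](addrAC _ (a *: k)).
Qed.

Lemma frame_gram : F z z = 0 ->
  gram_mx F (frame_tuple w k z) = normal_form_mx K d.+1.
Proof.
move=> Fzz; have nthP (i : 'I_d.+3) : [\/ i = 0%N :> nat,
    exists j : 'I_d, i = j.+1 :> nat, i = d.+1 :> nat | i = d.+2 :> nat].
  case: i => -[|i] /= lt_i; first by constructor 1.
  have [lt_id|le_di] := ltnP i d; first by constructor 2; exists (Ordinal lt_id).
  have [->|->] : i = d \/ i = d.+1 by lia.
    by constructor 3.
  by constructor 4.
apply/matrixP => i j; rewrite !mxE -val_eqE /=.
have e0 : (frame_tuple w k z)`_0 = 1 by [].
have [-> | [i' ->] | -> | ->] := nthP i; have [-> | [j' ->] | -> | ->] := nthP j;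
  rewrite ?e0 ?frame_tuple_w ?frame_tuple_k ?frame_tuple_z ?F11 ?frame_k_r
    ?(frame_1w frameP) ?(frame_k frameP) ?(frame_1z frameP) ?(frame_zw frameP)
    ?(frame_ww frameP) ?Fzz ?(symC F _ 1) ?(frame_1w frameP) ?(frame_1z frameP)
    ?(symC F _ z) ?(frame_zw frameP) ?Fzz //=.
all: rewrite ?eqSS ?andbF ?ltnn ?eqxx ?ltnS ?ltn_ord ?andbT //=.
all: try by case: ifP => //; try have := ltn_ord i'; try have := ltn_ord j'; lia.
by rewrite -val_eqE; case: eqP; rewrite ?oppr0.
Qed.

(** Since [k] is in the radical, [z] may be shifted by it; together with rescaling [k] this
    normalises the case d = 1. *)
Lemma form_frame_addz a : form_frame w k (z + a *: k).
Proof.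
have [F1w Fk nz_k F1z Fzw Fww] := frameP; split=> // [|i].
  by rewrite symDr symZr frame_k_r mulr0 addr0.
by rewrite symDl symZl Fk mulr0 addr0.
Qed.

Lemma form_frame_scalek a : a != 0 -> form_frame w (a *: k) z.
Proof.
have [F1w Fk nz_k F1z Fzw Fww] := frameP => nz_a; split=> // [x|].
  by rewrite symZl Fk mulr0.
by rewrite scaler_eq0 negb_or nz_a.
Qed.

End Frames.

(** * Consequences of the invariance under the hyperplane *)

Section InvariantForm.
Variables (K : closedFieldType) (nz2 : 2%:R != 0 :> K).
Variables (d : nat) (d_gt0 : (0 < d)%N).
Variables (R : comFalgType K) (dimR : \dim {:R} = d.+3).
Variables (m : {vspace R}) (locR : local_with_maximal_ideal m).
Variables (F : {symmetric R}) (F11 : F 1 1 = 0).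
Variables (W : {vspace R}) (W_sub : (W <= m)%VS) (W_hyp : \dim m = (\dim W).+1).
Hypothesis F_inv : forall a b1 b2 : R,
  a \in W -> F (a * b1) b2 + F b1 (a * b2) = 0.

Lemma sym_invariant a b1 b2 : a \in W -> F (a * b1) b2 = - F b1 (a * b2).
Proof. by move=> Wa; apply/eqP; rewrite -addr_eq0 F_inv. Qed.

Lemma double_eq0 (c : K) : c = - c -> c = 0.
Proof.
by move/eqP; rewrite -addr_eq0 -mulr2n -mulr_natl mulf_eq0 (negPf nz2) => /eqP.
Qed.

Lemma sym_1W a : a \in W -> F 1 a = 0.
Proof.
move=> Wa; apply: double_eq0.
by have := sym_invariant 1 1 Wa; rewrite !mulr1 symC.
Qed.

Lemma W_in_max a : a \in W -> a \in m.
Proof. exact/subvP. Qed.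

Lemma dim_W : \dim m = d.+2 /\ \dim W = d.+1.
Proof.
suff dim_m : \dim m = d.+2 by split=> //; move: W_hyp; rewrite dim_m => -[].
have : (\dim {:R} <= (\dim m).+1)%N.
  have <- : (m + <[1]>)%VS = fullv.
    apply/vspaceP => x; rewrite memvf; have [c mxc] := residue_scalar x locR.
    by rewrite -[x](subrK c%:A) memv_add ?memvZ ?memv_line.
  by rewrite (leq_trans (dimv_add_leqif _ _)) // dim_vline oner_eq0 addn1.
have : (\dim m < \dim {:R})%N.
  rewrite ltn_neqAle dimvS ?subvf // andbT.
  apply: contra (max_ideal_proper locR) => /eqP eq_dim.
  by have /eqP -> : (m == fullv)%VS; rewrite ?memvf // eqEdim subvf eq_dim /=.
by rewrite dimR => ? ?; lia.
Qed.

(** The functional F(1, -) vanishes on [W] and is 1 at [z], so [m] is the direct sum of [W] and the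
    line of [z], with F(1, x) as coefficient. *)
Lemma max_decomposition z x : F 1 z = 1 -> z \in m -> x \in m ->
  x - F 1 x *: z \in W.
Proof.
move=> F1z mz; have <- : (W + <[z]>)%VS = m.
  apply/eqP; rewrite eqEdim subv_add W_sub -memvE mz /=.
  have Wz0 : (W :&: <[z]> = 0)%VS.
    apply/eqP; rewrite -subv0; apply/subvP => y; rewrite memv_cap memv0.
    case/andP=> Wy /vlineP[c def_y]; move: (sym_1W Wy).
    by rewrite def_y symZr F1z mulr1 => ->; rewrite scale0r.
  have nz_z : z != 0.
    by apply: contra_eq_neq F1z => ->; rewrite symC sym0l eq_sym oner_eq0.
  by rewrite dimv_disjoint_sum // dim_vline nz_z addn1 W_hyp.
case/memv_addP=> a Wa [_ /vlineP[c ->] ->].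
by rewrite symDr symZr sym_1W // F1z add0r mulr1 addrK.
Qed.

Lemma W_neq0 : exists2 a, a \in W & a != 0.
Proof.
exists (vpick W); first exact: memv_pick.
by rewrite vpick0 -dimv_eq0 dim_W.2.
Qed.

Lemma exists_kernel_vector : form_rank F = d.+2 ->
  exists k z, [/\ k \in W, k != 0, forall x, F k x = 0
    & forall y, (forall x, F y x = 0) -> y \in <[k]>%VS]
  /\ [/\ forall a, a \in W -> a * k = 0, z \in m & F 1 z = 1].
Proof.
move=> rankF; have [|k [nz_k Fk kerF]] := @form_rank_kernel K R F.
  by rewrite rankF dimR.
(* By invariance a k lies in the radical, so a k = c k; if c were nonzero, a - c would be a unit
   annihilating [k]. *)
have Wk0 a : a \in W -> a * k = 0.
  move=> Wa; have /vlineP [c ak] : a * k \in <[k]>%VS.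
    by apply: kerF => x; rewrite sym_invariant // Fk oppr0.
  have [c0 | nz_c] := eqVneq c 0; first by rewrite ak c0 scale0r.
  have unit_ac : a - c%:A \is a GRing.unit.
    apply: (unit_notin_max locR); apply: contra nz_c => m_ac.
    rewrite -(algebra_scalar_in_max locR).
    by rewrite -[c%:A](subKr a) rpredB // W_in_max.
  case/eqP: nz_k; apply: (mulrI unit_ac).
  by rewrite mulrBl ak mulr_algl subrr mulr0.
(* Otherwise [k] is a unit annihilated by the nonzero space [W]. *)
have mk : k \in m.
  apply: contraT => /(unit_notin_max locR) unit_k.
  have [a Wa /eqP[]] := W_neq0.
  by apply: (mulIr unit_k); rewrite Wk0 // mul0r.
(* Otherwise 1 would lie in the radical, which is contained in [m]. *)
have [x nz_F1x] : exists x, F 1 x != 0.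
  pose e := vbasis {:R}.
  have [/existsP [i]|/existsPn F1e0] :=
      boolP [exists i : 'I_(\dim {:R}), F 1 e`_i != 0].
    by exists e`_i.
  have /vlineP [c def_1] : 1 \in <[k]>%VS.
    apply: kerF => x; rewrite (coord_vbasis (memvf x)) sym_sumr big1 // => i _.
    by rewrite symZr; have /negPn/eqP -> := F1e0 i; rewrite mulr0.
  by case/negP: (max_ideal_proper locR); rewrite def_1 memvZ.
have [c mxc] := residue_scalar x locR.
pose z := (F 1 x)^-1 *: (x - c%:A).
have mz : z \in m by rewrite memvZ.
have F1z : F 1 z = 1.
  by rewrite symZr symC symBl symZl F11 mulr0 subr0 symC mulVf.
exists k, z; do !split=> //.
by have := max_decomposition F1z mz mk; rewrite symC Fk scale0r subr0.
Qed.

Lemma exists_form_frame : form_rank F = d.+2 -> exists w k z,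
  [/\ form_frame F w k z, forall i : 'I_d, w i \in W, k \in W, z \in m
    & forall a, a \in W -> a * k = 0].
Proof.
case/exists_kernel_vector=> k [z1 [[Wk nz_k Fk kerF] [Wk0 mz1 F1z1]]].
pose U := (W :\: <[k]>)%VS.
have sUW : (U <= W)%VS by apply: diffvSl.
have sKW : (<[k]> <= W)%VS by rewrite -memvE.
have dimU : \dim U = d.
  have /eqP := dimv_cap_compl W <[k]>.
  by rewrite (capv_idPr sKW) dim_vline nz_k dim_W.2 eqSS => /eqP.
have [b b_basis] : exists b : d.-tuple R, basis_of U b.
  by rewrite -dimU; exists (vbasis U); apply: vbasisP.
(* The sign is chosen because the target values are F(w_i, w_i) = -1. *)
pose G := - gram_mx F b.
have symG : G^T = G by rewrite linearN /= tr_gram_mx.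
have Ub (i : 'I_d) : b`_i \in U by rewrite (basis_mem b_basis) // mem_nth ?size_tuple.
have unitG : G \in unitmx.
  rewrite -row_free_unit; apply: inj_row_free => v vG0.
  pose x := \sum_i v 0 i *: b`_i.
  have Ux : x \in U by rewrite rpred_sum // => i _; rewrite rpredZ.
  have FxW a : a \in W -> F x a = 0.
    rewrite -{1}(addv_diff_cap W <[k]>) (capv_idPr sKW) -/U.
    case/memv_addP => u Uu [_ /vlineP[c ->] ->]; rewrite symDr symZr (symC F x k) Fk.
    rewrite mulr0 addr0 (coord_basis b_basis Uu) sym_sumr big1 // => i _.
    by rewrite symZr sym_gram_mx -[_ *m _]opprK -mulmxN vG0 oppr0 mxE mulr0.
  have Wx : x \in W by apply: subvP Ux.
  (* With [x] orthogonal to [W], this vector is orthogonal to [W], [z1] and 1, hence to R. So it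
     lies in the radical, the scalar is in [m] and vanishes, and [x] is in both [U] and the line of
     [k]. *)
  have : x - (F x z1)%:A \in <[k]>%VS.
    apply: kerF => y; have [c myc] := residue_scalar y locR.
    have := max_decomposition F1z1 mz1 myc; set r := F 1 _; set a := _ - r *: _.
    have -> : y = a + r *: z1 + c%:A by rewrite !subrK.
    clearbody a r => Wa; rewrite symBl symZl !symDr !symZr (FxW a Wa) (sym_1W Wa).
    by rewrite F1z1 F11 (symC F x 1) (sym_1W Wx); ring.
  case/vlineP=> c xk.
  have Fxz1 : F x z1 = 0.
    apply/eqP; rewrite -(algebra_scalar_in_max locR) -[_%:A](subKr x) xk.
    by rewrite rpredB ?rpredZ // W_in_max.
  rewrite Fxz1 scale0r subr0 in xk.
  have x0 : x = 0.
    apply/eqP; rewrite -memv0 -(capv_diff W <[k]>) memv_cap Ux xk.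
    by rewrite memvZ ?memv_line.
  apply/rowP => i; rewrite mxE.
  by have /freeP/(_ (v 0) x0) := basis_free b_basis; apply.
have [im im2] := closed_field_sqrt (-1 : K).
(* The canonical form of the zero matrix merely yields an orthonormal basis. *)
have [_ [P [_ _ PG _]]] := symmetric_mx_canonical nz2 im2 symG unitG (trmx0 _ _ _).
pose w i := \sum_j P i j *: b`_j.
have Ww i : w i \in W.
  by rewrite rpred_sum // => j _; rewrite rpredZ // (subvP sUW).
have Fww i j : F (w i) (w j) = - (i == j)%:R.
  rewrite sym_lincomb_mx -/(gram_mx F b) -[gram_mx F b]opprK -/G.
  by rewrite mulmxN mulNmx PG !mxE.
(* As F(w_i, w_i) = -1, the plus sign makes [z] orthogonal to every [w i]. *)
pose z := z1 + \sum_i F z1 (w i) *: w i.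
exists w, k, z; split=> //; last first.
  by rewrite rpredD // rpred_sum // => i _; rewrite rpredZ // W_in_max.
split=> // [i||i]; first exact: sym_1W.
  by rewrite symDr F1z1 sym_1W ?addr0 // rpred_sum // => i _; rewrite rpredZ.
rewrite symDl sym_suml (bigD1 i) //= big1 => [|j ne_j].
  by rewrite addr0 symZl Fww eqxx mulrN1 subrr.
by rewrite symZl Fww (negPf ne_j) oppr0 mulr0.
Qed.

(** * The multiplication table of a frame *)

Section Products.
Variables (w : 'I_d -> R) (k z : R).
Hypotheses (frameP : form_frame F w k z) (Ww : forall i, w i \in W).
Hypotheses (Wk : k \in W) (mz : z \in m) (Wk0 : forall a, a \in W -> a * k = 0).

Lemma frame_coord_W x : x \in m ->
  exists a, x = a *: k - \sum_i F x (w i) *: w i + F x 1 *: z.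
Proof.
by move=> mx; apply: (frame_coord_max dimR F11 frameP locR) => // [i|];
  apply: W_in_max.
Qed.

Lemma sym_mul_1 i x : F (w i * x) 1 = - F x (w i).
Proof. by rewrite sym_invariant // mulr1. Qed.

Lemma sym_mul_ww_w i j l : F (w i * w j) (w l) = 0.
Proof.
have cycle a b c : F (w a * w b) (w c) = - F (w b * w c) (w a).
  by rewrite mulrC [LHS]sym_invariant // symC.
apply: double_eq0.
by rewrite {1}cycle {1}cycle {1}cycle !opprK.
Qed.

(** The coefficient on [z] is F(w_i w_j, 1) = -F(w_j, w_i), and those on the [w l] vanish by
    [sym_mul_ww_w]. *)
Lemma exists_structure_mx : exists M : 'M[K]_d,
  forall i j, w i * w j = (i == j)%:R *: z + M i j *: k.
Proof.
have coef i j : exists c, w i * w j = (i == j)%:R *: z + c *: k.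
  have [|c def_ij] := @frame_coord_W (w i * w j).
    by rewrite max_ideal_mull // W_in_max.
  exists c; rewrite def_ij sym_mul_1 (frame_ww frameP) opprK eq_sym addrC.
  by rewrite big1 ?subr0 // => l _; rewrite sym_mul_ww_w scale0r.
have [f fP] : exists f : 'I_d -> 'I_d -> K, forall i j,
    w i * w j = (i == j)%:R *: z + f i j *: k.
  have row i : exists g : 'I_d -> K, forall j,
      w i * w j = (i == j)%:R *: z + g j *: k.
    exact: fin_all_exists (coef i).
  exact: fin_all_exists row.
by exists (\matrix_(i, j) f i j) => i j; rewrite mxE.
Qed.

Variable M : 'M[K]_d.
Hypothesis (wwE : forall i j, w i * w j = (i == j)%:R *: z + M i j *: k).

Lemma tr_structure_mx : M^T = M.
Proof.
apply/matrixP => i j; rewrite mxE; apply/eqP; rewrite -subr_eq0.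
have : (M j i - M i j) *: k == 0.
  rewrite scalerBl subr_eq0; apply/eqP; apply: (addrI ((i == j)%:R *: z)).
  by rewrite -wwE mulrC wwE eq_sym.
by rewrite scaler_eq0 (negPf (frame_nz_k frameP)) orbF.
Qed.

Lemma frame_zE i : z = w i * w i - M i i *: k.
Proof. by rewrite wwE eqxx scale1r addrK. Qed.

(** [W] annihilates [k], and so does [z], being w_i^2 minus a multiple of [k]. *)
Lemma mul_frame_k x : x \in m -> x * k = 0.
Proof.
move=> mx; have [c ->] := frame_coord_W mx.
have zk : z * k = 0.
  rewrite (frame_zE (Ordinal d_gt0)) mulrBl -mulrA Wk0 // mulr0 -scalerAl Wk0 //.
  by rewrite scaler0 subr0.
rewrite mulrDl mulrBl -!scalerAl zk Wk0 // mulr_suml big1 => [|i _].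
  by rewrite !scaler0 subr0 addr0.
by rewrite -scalerAl Wk0 // scaler0.
Qed.

(** The coefficient on w_j is -F(w_i z, w_j) = F(z, w_i w_j), which is F(z, z) for j = i and 0
    otherwise. *)
Lemma mul_frame_wz i : exists c, w i * z = F z z *: w i + c *: k.
Proof.
have [|c def_wz] := @frame_coord_W (w i * z).
  by rewrite mulrC max_ideal_mull // W_in_max.
exists c; rewrite def_wz sym_mul_1 (frame_zw frameP) oppr0 scale0r addr0 addrC.
congr (_ + _); rewrite (bigD1 i) //= big1 => [|j ne_ji];
  rewrite sym_invariant // wwE symDr !symZr (frame_k_r frameP) mulr0 addr0.
  by rewrite eqxx mul1r addr0 scaleNr opprK.
by rewrite eq_sym (negPf ne_ji) mul0r oppr0 scale0r.
Qed.

(** If F(z, z) is nonzero, z - F(z, z) is a unit; it sends w_0 to a multiple of [k] and hence w_0^2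
    to 0. So w_0^2 = 0, against F(w_0^2, 1) = -F(w_0, w_0) = 1. *)
Lemma frame_zz : F z z = 0.
Proof.
have [c def_wz] := mul_frame_wz (Ordinal d_gt0); set w0 := w _ in def_wz.
have mw0 : w0 \in m by apply/W_in_max/Ww.
have [// | nz_zz] := eqVneq (F z z) 0.
have unit_z : z - (F z z)%:A \is a GRing.unit.
  apply: (unit_notin_max locR); apply: contra nz_zz => m_z.
  by rewrite -(algebra_scalar_in_max locR) -[_%:A](subKr z) rpredB.
have : F (w0 * w0) 1 = 0.
  rewrite (_ : w0 * w0 = 0) ?sym0l //; apply: (mulrI unit_z).
  rewrite mulr0 mulrCA mulrBl [z * _]mulrC def_wz mulr_algl addrAC subrr add0r.
  by rewrite -scalerAr mul_frame_k // scaler0.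
by rewrite sym_mul_1 (frame_ww frameP) eqxx opprK => /eqP; rewrite oner_eq0.
Qed.

Lemma form_frame_rotate (P : 'M[K]_d) : P *m P^T = 1%:M ->
  let w' i := \sum_j P i j *: w j in
  form_frame F w' k z /\
  (forall i j, w' i * w' j = (i == j)%:R *: z + (P *m M *m P^T) i j *: k).
Proof.
move=> PP w'; split.
  have Fww' i j : F (w' i) (w' j) = - (i == j)%:R.
    rewrite sym_lincomb_mx (_ : \matrix_(_, _) _ = - 1%:M); last first.
      by apply/matrixP => a b; rewrite !mxE (frame_ww frameP).
    by rewrite mulmxN mulNmx mulmx1 PP !mxE.
  have Fw' x i : (forall j, F x (w j) = 0) -> F x (w' i) = 0.
    by move=> Fxw; rewrite sym_sumr big1 // => j _; rewrite symZr Fxw mulr0.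
  by case: frameP; split=> // i; apply: Fw'.
(* This gives both coefficients the same double-sum shape P X P^T. *)
move=> i j; have -> : (i == j)%:R = (P *m 1%:M *m P^T) i j.
  by rewrite mulmx1 PP mxE.
rewrite 2!mxE !scaler_suml -big_split /= mulr_sumr; apply: eq_bigr => b _.
rewrite mulr_suml !mxE !mulr_suml !scaler_suml -big_split /=.
apply: eq_bigr => a _; rewrite -scalerAl -scalerAr wwE !scalerDr !scalerA mxE.
by congr (_ *: _ + _ *: _); rewrite mulrAC.
Qed.

(** Each list is free, contained in its space and of the right length, so it spans. *)
Lemma frame_tuple_adapted (e := frame_tuple w k z) :
  [/\ basis_of {:R} e, e`_0 = 1, W = <<[seq e`_i | i <- iota 1 d.+1]>>%VS,
      m = <<[seq e`_i | i <- iota 1 d.+2]>>%VS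
    & gram_mx F e = normal_form_mx K d.+1].
Proof.
have e_basis := frame_basis dimR F11 frameP; have [dim_m dimW] := dim_W.
have free_wkz : free (rcons (rcons (mktuple w) k) z).
  by have := basis_free e_basis; rewrite free_cons => /andP[].
have free_wk : free (rcons (mktuple w) k).
  by move: free_wkz; rewrite -[X in free X]cats1 => /catl_free.
have W_wk x : x \in rcons (mktuple w) k -> x \in W.
  by rewrite mem_rcons inE => /predU1P[-> // | /mapP[i _ ->]].
have span_eq (U : {vspace R}) (s : seq R) : free s -> \dim U = size s ->
    (forall x, x \in s -> x \in U) -> U = <<s>>%VS.
  move=> free_s dimU sU; apply/eqP; rewrite eq_sym eqEdim dimU (eqP free_s) leqnn andbT.
  by apply/span_subvP.
have size_wk : size (rcons (mktuple w) k) = d.+1 by rewrite size_rcons size_tuple.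
have size_wkz : size (rcons (rcons (mktuple w) k) z) = d.+2.
  by rewrite size_rcons size_wk.
have nth_e n : (n <= d.+2)%N ->
    [seq e`_i | i <- iota 1 n] = take n (rcons (rcons (mktuple w) k) z).
  by move=> le_n; rewrite map_nth_iota ?size_tuple //= drop0.
split=> //; last exact/frame_gram/frame_zz.
  rewrite nth_e // -[rcons _ z]cats1 (take_size_cat _ size_wk).
  by apply: span_eq => //; rewrite dimW size_wk.
rewrite nth_e // take_oversize ?size_wkz //.
apply: span_eq => //; first by rewrite dim_m size_wkz.
by move=> x; rewrite mem_rcons inE => /predU1P[-> // | /W_wk/W_in_max].
Qed.

End Products.
End InvariantForm.

(** * Presentations *)

Section GeneratedIdeals.
Variables (A : comNzRingType) (S : A -> Prop).

Lemma ideal_gen p : S p -> in_ideal_generated_by S p.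
Proof.
move=> Sp; exists [:: (1, p)]; rewrite big_seq1 mul1r; split=> // x.
by rewrite inE => /eqP ->.
Qed.

Lemma ideal0 : in_ideal_generated_by S 0.
Proof. by exists [::]; rewrite big_nil. Qed.

Lemma idealD p q : in_ideal_generated_by S p -> in_ideal_generated_by S q ->
  in_ideal_generated_by S (p + q).
Proof.
move=> [s [Ss ->]] [t [St ->]]; exists (s ++ t); rewrite big_cat; split=> // x.
by rewrite mem_cat => /orP[/Ss | /St].
Qed.

Lemma ideal_mull a p : in_ideal_generated_by S p -> in_ideal_generated_by S (a * p).
Proof.
move=> [s [Ss ->]]; exists [seq (a * x.1, x.2) | x <- s]; split=> [x|].
  by case/mapP=> y sy ->; apply: (Ss y).
by rewrite big_map mulr_sumr; apply: eq_bigr => x _; rewrite mulrA.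
Qed.

Lemma idealN p : in_ideal_generated_by S p -> in_ideal_generated_by S (- p).
Proof. by rewrite -mulN1r; apply: ideal_mull. Qed.

Lemma idealB p q : in_ideal_generated_by S p -> in_ideal_generated_by S q ->
  in_ideal_generated_by S (p - q).
Proof. by move=> Ip Iq; apply/idealD/idealN. Qed.

End GeneratedIdeals.

(** * A criterion for presentations by reduction to normal forms *)

Section Presentations.
Variables (K : fieldType) (R : comFalgType K) (d : nat) (v : 'I_d -> R).
Variables (S : {mpoly K[d]} -> Prop) (N : nat) (b : 'I_N -> {mpoly K[d]}).

Local Notation ev := (mmap (GRing.in_alg R) v).

(** The [b j] play the role of a monomial basis of the quotient by the ideal. *)
Definition reducible (p : {mpoly K[d]}) : Prop :=
  exists c : 'I_N -> K, in_ideal_generated_by S (p - \sum_j c j *: b j).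

Lemma reducibleD p q : reducible p -> reducible q -> reducible (p + q).
Proof.
move=> [c Ip] [c' Iq]; exists (fun j => c j + c' j).
under eq_bigr do rewrite scalerDl.
by rewrite big_split /= opprD addrACA; apply: idealD.
Qed.

Lemma reducibleZ a p : reducible p -> reducible (a *: p).
Proof.
move=> [c Ip]; exists (fun j => a * c j).
under eq_bigr do rewrite -scalerA.
by rewrite -scaler_sumr -scalerBr -mul_mpolyC; apply: ideal_mull.
Qed.

Lemma reducible_sum (I : finType) (p : I -> {mpoly K[d]}) :
  (forall i, reducible (p i)) -> reducible (\sum_i p i).
Proof.
move=> red_p; elim/big_ind: _ => //; last exact: reducibleD.
by exists (fun=> 0); rewrite big1 ?subrr => [|j _]; [exact: ideal0 | rewrite scale0r].
Qed.

Lemma reducible_b j : reducible (b j).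
Proof.
exists (fun i => (i == j)%:R); rewrite (bigD1 j) //= eqxx scale1r big1.
  by rewrite addr0 subrr; apply: ideal0.
by move=> i /negPf ->; rewrite scale0r.
Qed.

Lemma reducible_ideal p : in_ideal_generated_by S p -> reducible p.
Proof.
by move=> Ip; exists (fun=> 0); rewrite big1 ?subr0 // => j _; rewrite scale0r.
Qed.

Lemma reducible_congr p q : in_ideal_generated_by S (p - q) -> reducible q -> reducible p.
Proof. by move=> /reducible_ideal red_pq /(reducibleD red_pq); rewrite subrK. Qed.

Hypothesis S_ker : forall p, S p -> ev p = 0.
Hypothesis ev_basis : basis_of {:R} [tuple ev (b j) | j < N].
Hypothesis red_1 : reducible 1.
Hypothesis red_Xb : forall i j, reducible ('X_i * b j).

Lemma ideal_ker p : in_ideal_generated_by S p -> ev p = 0.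
Proof.
move=> [s [Ss ->]]; rewrite raddf_sum big_seq big1 // => x /Ss /S_ker.
by rewrite /= rmorphM /= => ->; rewrite mulr0.
Qed.

Lemma reducible_mulX i p : reducible p -> reducible ('X_i * p).
Proof.
move=> [c Ip]; apply: (@reducible_congr _ ('X_i * \sum_j c j *: b j)).
  by rewrite -mulrBr; apply: ideal_mull.
rewrite mulr_sumr; apply: reducible_sum => j.
by rewrite -scalerAr; apply/reducibleZ/red_Xb.
Qed.

(** Reducible polynomials form a subspace containing 1 and stable under multiplication by the
    variables. *)
Lemma all_reducible p : reducible p.
Proof.
elim/mpolyind: p => [|c mn p _ _ red_p]; first exact/reducible_ideal/ideal0.
apply: reducibleD => //; apply: reducibleZ; rewrite mpolyXE_id.
elim/big_rec: _ => // i q _ red_q.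
elim: (mn i) => [|k IHk]; rewrite ?expr0 ?mul1r // exprS -mulrA.
exact: reducible_mulX.
Qed.

(** A kernel element is congruent to a combination of the [b j], whose coefficients vanish because
    the evaluations are independent. *)
Lemma presented_by_reduction : presented_by v S.
Proof.
have ev_comb (c : 'I_N -> K) :
    ev (\sum_j c j *: b j) = \sum_j c j *: [tuple ev (b j) | j < N]`_j.
  rewrite raddf_sum; apply: eq_bigr => j _.
  by rewrite -tnth_nth tnth_mktuple /= mmapZ mulr_algl.
split=> [x|p].
  exists (\sum_j coord [tuple ev (b j) | j < N] j x *: b j).
  by rewrite ev_comb -(coord_basis ev_basis) ?memvf.
split=> [ev_p0 | /ideal_ker //]; have [c Ip] := all_reducible p.
have c0 j : c j = 0.
  have /freeP free_b := basis_free ev_basis; apply: (free_b c); rewrite -ev_comb.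
  have := ideal_ker Ip; rewrite rmorphB /= ev_p0 sub0r => /eqP.
  by rewrite oppr_eq0 => /eqP.
by rewrite big1 ?subr0 in Ip => [|j _]; rewrite ?c0 ?scale0r.
Qed.

End Presentations.

(** * Presentations read off from a frame *)

Section FramePresentation.
Variables (K : fieldType) (R : comFalgType K) (d : nat) (d_gt0 : (0 < d)%N).
Variables (w : 'I_d -> R) (k z : R) (M : 'M[K]_d).
Hypothesis e_basis : basis_of {:R} (frame_tuple w k z).
Hypothesis wwE : forall i j, w i * w j = (i == j)%:R *: z + M i j *: k.

Local Notation X i := ('X_(widen_ord (leqnSn d) i) : {mpoly K[d.+1]}).
Local Notation Y := ('X_ord_max : {mpoly K[d.+1]}).
Local Notation i0 := (Ordinal d_gt0).
(** [z] is not one of the generators; this polynomial represents it. *)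
Local Notation Z := (X i0 ^+ 2 - M i0 i0 *: Y).
Local Notation v := (fun i : 'I_d.+1 => (frame_tuple w k z)`_i.+1).
Local Notation ev := (mmap (GRing.in_alg R) v).

Lemma frame_ev_X i : ev (X i) = w i.
Proof. by rewrite mmapX mmap1U frame_tuple_w. Qed.

Lemma frame_ev_Y : ev Y = k.
Proof. by rewrite mmapX mmap1U frame_tuple_k. Qed.

Lemma frame_ev_Z : ev Z = z.
Proof.
rewrite rmorphB rmorphXn /= frame_ev_X mmapZ frame_ev_Y /= mulr_algl expr2 wwE.
by rewrite eqxx scale1r addrK.
Qed.

Lemma ord_widen_maxP (P : 'I_d.+1 -> Prop) :
  (forall i, P (widen_ord (leqnSn d) i)) -> P ord_max -> forall i, P i.
Proof.
move=> Pw Pm i; have [lt_id | le_di] := ltnP i d.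
  by rewrite (_ : i = widen_ord (leqnSn d) (Ordinal lt_id)) //; apply: val_inj.
rewrite (_ : i = ord_max) //; apply: val_inj.
by apply/eqP; rewrite eqn_leq le_di -ltnS ltn_ord.
Qed.

Lemma frame_presentation (S : {mpoly K[d.+1]} -> Prop) :
  (forall p, S p -> ev p = 0) ->
  (forall i j, in_ideal_generated_by S (X i * X j - (i == j)%:R *: Z - M i j *: Y)) ->
  (forall s, in_ideal_generated_by S ('X_s * Y)) ->
  (forall i, in_ideal_generated_by S (X i * Z)) ->
  presented_by v S.
Proof.
move=> S_ker I_XX I_Y I_XZ.
(* Normal forms in the order of the frame: 1, the d + 1 variables, then Z. *)
pose b (j : 'I_d.+3) : {mpoly K[d.+1]} :=
  if j == 0%N :> nat then 1 else if j == d.+2 :> nat then Z else 'X_(inord j.-1).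
have b0 : b ord0 = 1 by [].
have bz : b ord_max = Z by rewrite /b /= eqxx.
have bx (i : 'I_d.+1) : b (lift ord0 (widen_ord (leqnSn d.+1) i)) = 'X_i.
  by rewrite /b /= /bump /= eqSS ltn_eqF ?ltn_ord // inord_val.
have bP (P : 'I_d.+3 -> Prop) : P ord0 -> P ord_max ->
    (forall i : 'I_d.+1, P (lift ord0 (widen_ord (leqnSn d.+1) i))) -> forall j, P j.
  move=> P0 Pm Px j; case: (unliftP ord0 j) => [j'|] -> //.
  have [lt_j | le_j] := ltnP j' d.+1.
    have -> : j' = widen_ord (leqnSn d.+1) (Ordinal lt_j) by apply: val_inj.
    exact: Px.
  suff -> : lift ord0 j' = ord_max by [].
  apply: val_inj; rewrite /= /bump /=; congr _.+1; apply/eqP.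
  by rewrite eqn_leq le_j -ltnS ltn_ord.
have ev_b j : ev (b j) = (frame_tuple w k z)`_j.
  elim/bP: j => [||i]; first by rewrite b0 rmorph1.
    by rewrite bz frame_ev_Z frame_tuple_z.
  by rewrite bx mmapX mmap1U lift0.
have red_b j : reducible S b (b j) by apply: reducible_b.
have red_Y : reducible S b Y by rewrite -bx.
apply: (@presented_by_reduction _ _ _ _ _ _ b) => //.
  suff -> : [tuple ev (b j) | j < d.+3] = frame_tuple w k z by [].
  by apply: eq_from_tnth => j; rewrite tnth_mktuple ev_b -tnth_nth.
  by rewrite -b0.
move=> i j; elim/bP: j => [||j]; first by rewrite b0 mulr1 -bx.
  rewrite bz; elim/ord_widen_maxP: i => [i|]; first exact/reducible_ideal.
  have -> : Y * Z = X i0 * (X i0 * Y) - (M i0 i0)%:MP * (Y * Y).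
    by rewrite -mul_mpolyC; ring.
  by apply: reducible_ideal; apply: idealB; apply: ideal_mull; apply: I_Y.
rewrite bx; elim/ord_widen_maxP: j => [j|]; last exact/reducible_ideal.
elim/ord_widen_maxP: i => [i|]; last by rewrite mulrC; apply/reducible_ideal.
apply: (reducible_congr (q := (i == j)%:R *: Z + M i j *: Y)).
  by rewrite opprD addrA.
by apply: reducibleD; apply: reducibleZ => //; rewrite -bz.
Qed.

End FramePresentation.

Section LambdaPresentation.
Variables (K : fieldType) (R : comFalgType K) (d : nat) (d_gt1 : (1 < d)%N).
Variables (w : 'I_d -> R) (k z : R) (L : 'M[K]_d).
Hypothesis e_basis : basis_of {:R} (frame_tuple w k z).
Hypothesis wwE : forall i j, w i * w j = (i == j)%:R *: z + L i j *: k.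
Hypotheses (symL : L^T = L) (wk : forall i, w i * k = 0) (kk : k * k = 0).

Lemma Lambda_presentation :
  presented_by (fun i : 'I_d.+1 => (frame_tuple w k z)`_i.+1) (Lambda_relation L).
Proof.
pose d_gt0 := ltnW d_gt1; pose i0 := Ordinal d_gt0.
pose X i : {mpoly K[d.+1]} := 'X_(widen_ord (leqnSn d) i).
pose Y : {mpoly K[d.+1]} := 'X_ord_max.
pose Z := X i0 ^+ 2 - L i0 i0 *: Y.
have symLE i j : L i j = L j i by rewrite -[in LHS]symL mxE.
have I_XX i j : in_ideal_generated_by (Lambda_relation L)
    (X i * X j - (i == j)%:R *: Z - L i j *: Y).
  have [lt_ij | lt_ji | /val_inj <-] := ltngtP i j.
  - rewrite -val_eqE ltn_eqF // scale0r subr0; apply: ideal_gen; exact: LambdaMixed.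
  - rewrite -val_eqE gtn_eqF // scale0r subr0 symLE mulrC.
    apply: ideal_gen; exact: LambdaMixed.
  rewrite eqxx scale1r; have [-> | ne_i0] := eqVneq i i0.
    have -> : X i0 * X i0 - Z - L i0 i0 *: Y = 0 by rewrite /Z; ring.
    exact: ideal0.
  have -> : X i * X i - Z - L i i *: Y =
      - (X i0 ^+ 2 - X i ^+ 2 - (L i0 i0 - L i i) *: Y).
    by rewrite /Z scalerBl; ring.
  by apply/idealN/ideal_gen/LambdaSquare; rewrite lt0n -(inj_eq val_inj) in ne_i0 *.
have I_Y s : in_ideal_generated_by (Lambda_relation L) ('X_s * Y).
  by apply: ideal_gen; apply: LambdaSocle.
apply: (frame_presentation (d_gt0 := d_gt0) e_basis wwE) => //.
  move=> _ [i j lt_ij|i j lt_ij|s].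
  - rewrite rmorphB rmorphM /= !frame_ev_X mmapZ frame_ev_Y /= mulr_algl wwE.
    by rewrite -val_eqE ltn_eqF // scale0r add0r subrr.
  - rewrite !rmorphB !rmorphXn /= !frame_ev_X mmapZ frame_ev_Y /= mulr_algl.
    rewrite !expr2 !wwE !eqxx.
    by rewrite opprD addrACA subrr add0r scalerBl subrr.
  rewrite rmorphM /=; elim/ord_widen_maxP: s => [s|].
    by rewrite frame_ev_X frame_ev_Y.
  by rewrite frame_ev_Y.
(* Since d > 1 there is an index j different from i. Modulo the ideal Z is X_j^2 - L_jj Y, so X_i Z
   reduces through X_i X_j to multiples of Y that vanish. *)
move=> i; have [j ne_ij] : exists j : 'I_d, i != j.
  have [e_i|] := eqVneq (i : nat) 0%N; last by exists (Ordinal d_gt0).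
  by exists (Ordinal d_gt1); rewrite -val_eqE /= e_i.
have := I_XX j j; have := I_XX i j; rewrite eqxx (negPf ne_ij) scale0r scale1r subr0.
move=> I_ij I_jj.
have -> : X i * Z = X j * (X i * X j - L i j *: Y) + (L i j)%:MP * (X j * Y)
    - (L j j)%:MP * (X i * Y) - X i * (X j * X j - Z - L j j *: Y).
  by rewrite -!mul_mpolyC; ring.
by apply: idealB; [apply: idealB; [apply: idealD|]|]; apply: ideal_mull;
  [exact: I_ij | exact: I_Y | exact: I_Y | exact: I_jj].
Qed.

End LambdaPresentation.

(** * The two algebras for n = 2 *)

Section SmallPresentations.
Variables (K : fieldType) (R : comFalgType K).

(** With structure matrix 0 the polynomial Z is X_0^2, and the cubic relation says that X_0 Z
    vanishes. *)
Lemma cubic_presentation (w : 'I_1 -> R) (k z : R) :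
  basis_of {:R} (frame_tuple w k z) -> w 0 * w 0 = z -> w 0 * z = 0 ->
  w 0 * k = 0 -> k * k = 0 ->
  presented_by (fun i : 'I_2 => (frame_tuple w k z)`_i.+1)
    (fun p => p \in [:: 'X_0 ^+ 3; 'X_0 * 'X_1; 'X_1 ^+ 2]).
Proof.
move=> e_basis ww wz wk kk.
have wwE i j : w i * w j = (i == j)%:R *: z + (0 : 'M[K]_1) i j *: k.
  by rewrite !ord1 eqxx scale1r mxE scale0r addr0.
have X0 i : widen_ord (leqnSn 1) i = 0 by apply: val_inj; rewrite /= ord1.
have X1 : ord_max = 1 :> 'I_2 by apply: val_inj.
have evX0 := frame_ev_X w k z 0; rewrite X0 in evX0.
have evX1 := frame_ev_Y w k z; rewrite X1 in evX1.
pose S (p : {mpoly K[2]}) := p \in [:: 'X_0 ^+ 3; 'X_0 * 'X_1; 'X_1 ^+ 2].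
have I_00 : in_ideal_generated_by S ('X_0 ^+ 3).
  by apply: ideal_gen; rewrite /S !inE eqxx.
have I_01 : in_ideal_generated_by S ('X_0 * 'X_1).
  by apply: ideal_gen; rewrite /S !inE eqxx orbT.
have I_11 : in_ideal_generated_by S ('X_1 ^+ 2).
  by apply: ideal_gen; rewrite /S !inE eqxx !orbT.
apply: (frame_presentation (d_gt0 := ltn0Sn 0) e_basis wwE) => [p|i j|s|i].
- rewrite !inE => /or3P[] /eqP ->; rewrite ?rmorphXn ?rmorphM /= ?evX0 ?evX1.
  + by rewrite 2!exprS expr1 ww wz.
  + exact: wk.
  + exact: kk.
- rewrite !ord1 eqxx scale1r !X0 !mxE !scale0r !subr0 expr2 subrr.
  exact: ideal0.
- rewrite X1; elim/ord_widen_maxP: s => [s|]; first by rewrite X0.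
  by rewrite X1.
by rewrite !X0 mxE scale0r subr0 -exprS.
Qed.

Lemma quartic_presentation (a : R) :
  basis_of {:R} [:: 1; a; a ^+ 3; a ^+ 2] -> a ^+ 4 = 0 ->
  presented_by (fun _ : 'I_1 => a) (fun p : {mpoly K[1]} => p \in [:: 'X_0 ^+ 4]).
Proof.
move=> a_basis a4; pose b (j : 'I_4) : {mpoly K[1]} := 'X_0 ^+ j.
have ev_X n : mmap (GRing.in_alg R) (fun _ : 'I_1 => a) ('X_0 ^+ n) = a ^+ n.
  by rewrite rmorphXn /= mmapX mmap1U.
apply: (@presented_by_reduction _ _ _ _ _ _ b).
- by move=> p; rewrite inE => /eqP ->; rewrite ev_X.
- have -> : [tuple mmap (GRing.in_alg R) (fun _ : 'I_1 => a) (b j) | j < 4] =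
      [:: 1; a; a ^+ 2; a ^+ 3] :> seq R.
    by rewrite /= enum_ordSl; do !rewrite enum_ordSl; rewrite enum_ord0 /= !ev_X.
  rewrite (perm_basis _ (Y := [:: 1; a; a ^+ 3; a ^+ 2])) //.
  by rewrite !perm_cons (perm_catC [:: _] [:: _]).
- exact: (reducible_b _ b ord0).
move=> i j; rewrite ord1 -exprS; have [lt_j3 | ge_j3] := ltnP j 3.
  exact: (reducible_b _ b (Ordinal (lt_j3 : (j.+1 < 4)%N))).
have -> : j = 3%N :> nat by apply/eqP; rewrite eqn_leq ge_j3 -ltnS ltn_ord.
by apply/reducible_ideal/ideal_gen; rewrite inE.
Qed.

End SmallPresentations.

(** * Classification: rotation of the frame for n >= 3, direct normalisation for n = 2 *)

Theorem proposition7 (K : closedFieldType) (charK0 : [pchar K] =i pred0)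
    (im : K) (im_sqrt : im ^+ 2 = -1)
    (n : nat) (n_ge2 : (2 <= n)%N)
    (R : comFalgType K) (dimR : \dim {:R} = n.+2)
    (m : {vspace R}) (locR : local_with_maximal_ideal m)
    (F : {symmetric R}) (rankF : form_rank F = n.+1) (F11 : F 1 1 = 0)
    (W : {vspace R}) (W_sub : (W <= m)%VS) (W_hyp : \dim m = (\dim W).+1)
    (F_inv : forall a b1 b2 : R, a \in W -> F (a * b1) b2 + F b1 (a * b2) = 0) :
  exists e : n.+2.-tuple R,
    [/\ basis_of {:R} e,
        e`_0 = 1,
        W = <<[seq e`_k | k <- iota 1 n]>>%VS,
        m = <<[seq e`_k | k <- iota 1 n.+1]>>%VS
      & gram_mx F e = normal_form_mx K n]
    /\ ((3 <= n)%N ->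
        exists L : 'M[K]_n.-1,
          [/\ L^T = L,
              is_canonical_mx im L
            & presented_by (fun k : 'I_n.-1.+1 => e`_k.+1)
                (Lambda_relation L)])
    /\ (n = 2%N ->
        presented_by (fun k : 'I_2 => e`_k.+1)
          (fun p => p \in [:: 'X_0 ^+ 3; 'X_0 * 'X_1; 'X_1 ^+ 2])
        \/ [/\ e`_2 = e`_1 ^+ 3,
               e`_3 = e`_1 ^+ 2
             & presented_by (fun _ : 'I_1 => e`_1)
                 (fun p => p \in [:: 'X_0 ^+ 4])]).
Proof.
have nz2 : 2%:R != 0 :> K by have /pcharf0P -> := charK0.
case: n n_ge2 dimR rankF => [//|d] d_gt0 dimR rankF.
have [w [k [z [frameP Ww Wk mz Wk0]]]] :=
  exists_form_frame nz2 d_gt0 dimR locR F11 W_sub W_hyp F_inv rankF.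
have [M wwE] :=
  exists_structure_mx nz2 dimR locR F11 W_sub F_inv frameP Ww Wk mz.
have [d_gt1 | d_le1] := ltnP 1 d.
  have symM := tr_structure_mx frameP wwE.
  (* Taking the identity as Gram matrix makes [P] orthogonal, so rotating [w] by it preserves the
     frame and turns [M] into [L]. *)
  have [L [P [canL symL]]] :=
    symmetric_mx_canonical nz2 im_sqrt (trmx1 _ _) (unitmx1 _ _) symM.
  rewrite mulmx1 => PP defL.
  have [] := form_frame_rotate frameP wwE PP.
  set w' := fun i => _; rewrite defL => frameP' wwE'.
  have Ww' i : w' i \in W by rewrite rpred_sum // => j _; rewrite rpredZ.
  have adapted := frame_tuple_adapted nz2 d_gt0 dimR locR F11 W_sub W_hyp F_inv
    frameP' Ww' Wk mz Wk0 wwE'.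
  exists (frame_tuple w' k z); do !split=> //;
    last by case=> d1; rewrite d1 in d_gt1.
  move=> _; exists L; split=> //; have [e_basis _ _ _ _] := adapted.
  by apply: (Lambda_presentation d_gt1 e_basis wwE' symL) => [i|]; apply: Wk0.
have d1 : d = 1%N by lia.
subst d; clear d_le1.
(* For d = 1 the structure matrix is a scalar and is absorbed into [z], giving w_0^2 = z'. *)
pose z' := z + M 0 0 *: k.
have frameP1 := form_frame_addz frameP (M 0 0); rewrite -/z' in frameP1.
have mz' : z' \in m by rewrite rpredD // rpredZ // (subvP W_sub).
have ww : w 0 * w 0 = z' by rewrite wwE eqxx scale1r.
have wwE0 k' i j : w i * w j = (i == j)%:R *: z' + (0 : 'M[K]_1) i j *: k'.
  by rewrite !ord1 eqxx scale1r mxE scale0r addr0.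
have z'z' := frame_zz (ltn0Sn 0) dimR locR F11 W_sub F_inv frameP1 Ww Wk mz' Wk0
  (wwE0 k).
have [c wz'] := mul_frame_wz dimR locR F11 W_sub F_inv frameP1 Ww Wk mz' (wwE0 k) 0.
rewrite z'z' scale0r add0r in wz'.
(* Now w_0^3 = c k: for c = 0 the cube vanishes, otherwise replacing [k] by c k makes w_0 generate
   the algebra. *)
have [c0 | nz_c] := eqVneq c 0.
  have adapted := frame_tuple_adapted nz2 (ltn0Sn 0) dimR locR F11 W_sub W_hyp F_inv
    frameP1 Ww Wk mz' Wk0 (wwE0 k).
  exists (frame_tuple w k z'); split; [exact: adapted | split=> // _; left].
  have [e_basis _ _ _ _] := adapted.
  apply: cubic_presentation => //; last exact: Wk0; last exact: Wk0.
  by rewrite wz' c0 scale0r.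
have frameP2 := form_frame_scalek frameP1 nz_c.
have Wck : c *: k \in W by rewrite rpredZ.
have Wck0 a : a \in W -> a * (c *: k) = 0.
  by move=> Wa; rewrite -scalerAr Wk0 // scaler0.
have adapted := frame_tuple_adapted nz2 (ltn0Sn 0) dimR locR F11 W_sub W_hyp F_inv
  frameP2 Ww Wck mz' Wck0 (wwE0 (c *: k)).
exists (frame_tuple w (c *: k) z'); split; [exact: adapted | split=> // _; right].
have e1 : (frame_tuple w (c *: k) z')`_1 = w 0.
  by rewrite -(frame_tuple_w _ (c *: k) z').
have w2 : w 0 ^+ 2 = z' by rewrite expr2.
have w3 : w 0 ^+ 3 = c *: k by rewrite exprS w2.
rewrite e1 w2 w3; split; first exact: (frame_tuple_k w).
  exact: (frame_tuple_z w).
apply: quartic_presentation; last by rewrite exprS w3 Wck0.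
have [e_basis _ _ _ _] := adapted.
have <- : frame_tuple w (c *: k) z' = [:: 1; w 0; w 0 ^+ 3; w 0 ^+ 2] :> seq R.
  by rewrite w2 w3 /= enum_ordSl enum_ord0.
exact: e_basis.
Qed.
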